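(* In the Grothendieck group of $k\mathbf{FB}\otimes k\mathbf{FB}^{\mathrm{op}}$-modules, there is an equality $$[k\mathbf{FS}^0]+\sum_{b>a\ge 0}(-1)^{b-a}[\mathsf{sgn}_a\boxtimes\mathsf{sgn}_b]=[k\mathbf{FS}]\odot_{\mathbf{FB}^{\mathrm{op}}}\Big(\sum_{t\in\mathbb N}(-1)^t[\mathsf{sgn}_t]\Big).$$
   Context: $k$ is a field of characteristic zero; $\mathbb N=\{0,1,2,\dots\}$. $\mathbf{FS}$, $\mathbf{FI}$, $\mathbf{FB}$ are the categories of finite sets with, respectively, surjections, injections, bijections. For a category $\mathcal C$, $k\mathcal C$ is its $k$-linearization, with basis elements $[f]$. A module over a $k$-linear category is a $k$-linear functor from it to $k$-vector spaces; $\mathcal A\otimes\mathcal B$ has as objects pairs of objects and as morphism spaces the tensor products of morphism spaces. For an injection $i:V\hookrightarrow U$ and a surjection $f:U\twoheadrightarrow X$, put $i^*[f]=[f\circ i]$ if $f\circ i$ is surjective and $0$ otherwise. $k\mathbf{FS}^0(U,X)\subseteq k\mathbf{FS}(U,X)$ is the subspace of $x$ such that $i^*x=0$ for all injections $i:V\hookrightarrow U$ with $|V|=|U|-1$ (equivalently, for all non-bijective injections into $U$). $k\mathbf{FS}$ and $k\mathbf{FS}^0$ are $k\mathbf{FB}\otimes k\mathbf{FB}^{\mathrm{op}}$-modules via $(X,U)\mapsto k\mathbf{FS}(U,X)$, respectively $k\mathbf{FS}^0(U,X)$, with $k\mathbf{FB}$ acting by postcomposition and $k\mathbf{FB}^{\mathrm{op}}$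 by precomposition. $\odot_{\mathbf{FB}^{\mathrm{op}}}$ is the Day convolution of $k\mathbf{FB}^{\mathrm{op}}$-modules, $(M\odot_{\mathbf{FB}^{\mathrm{op}}}N)(S)=\bigoplus_{S=S_1\amalg S_2}M(S_1)\otimes N(S_2)$ (over ordered decompositions of $S$ into two subsets), and induces a product on classes by $[M]\odot_{\mathbf{FB}^{\mathrm{op}}}[N]=[M\odot_{\mathbf{FB}^{\mathrm{op}}}N]$; for $k\mathbf{FS}$ it is applied in the $k\mathbf{FB}^{\mathrm{op}}$-variable. $\mathsf{sgn}_t$ is the sign representation of $\mathfrak S_t$ considered as a $k\mathbf{FB}$- or $k\mathbf{FB}^{\mathrm{op}}$-module supported on sets of cardinality $t$; in $\mathsf{sgn}_a\boxtimes\mathsf{sgn}_b$ (external tensor product), $\mathsf{sgn}_a$ is the $k\mathbf{FB}$-module and $\mathsf{sgn}_b$ the $k\mathbf{FB}^{\mathrm{op}}$-module. All modules take finite-dimensional values; equalities involving infinite sums are understood after evaluation on each pair of finite sets, where only finitely many terms are non-zero. *)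

(* Defs.v *)
From HB Require Import structures.
From mathcomp Require Import all_boot all_order all_algebra all_fingroup.

Set Implicit Arguments.
Unset Strict Implicit.
Unset Printing Implicit Defensive.

Import GRing.Theory VectorInternalTheory.
Local Open Scope ring_scope.

Record category := Category {
  obj :> Type;
  arr : obj -> obj -> Type;
  idc : forall x, arr x x;
  cmp : forall x y z, arr y z -> arr x y -> arr x z;
  cmp1f : forall x y (f : arr x y), cmp (idc y) f = f;
  cmpf1 : forall x y (f : arr x y), cmp f (idc x) = f;
  cmpA : forall x y z t (h : arr z t) (g : arr y z) (f : arr x y),
    cmp h (cmp g f) = cmp (cmp h g) f
}.
Arguments arr {c} x y.
Arguments idc {c} x.
Arguments cmp {c x y z} g f.

Definition opc (C : category) : category :=
  @Category C (fun x y => @arr C y x) (@idc C) (fun x y z g f => cmp f g)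
    (fun x y f => cmpf1 f) (fun x y f => cmp1f f)
    (fun x y z t h g f => esym (cmpA f g h)).

Section ProdCat.
Variables C D : category.
Definition pcobj : Type := C * D.
Definition pchom (x y : pcobj) : Type := arr x.1 y.1 * arr x.2 y.2.
Definition pccmp (x y z : pcobj) (g : pchom y z) (f : pchom x y) : pchom x z :=
  (cmp g.1 f.1, cmp g.2 f.2).
Fact pccmp1f x y (f : pchom x y) : pccmp (idc y.1, idc y.2) f = f.
Proof. by case: f => f1 f2; rewrite /pccmp /= !cmp1f. Qed.
Fact pccmpf1 x y (f : pchom x y) : pccmp f (idc x.1, idc x.2) = f.
Proof. by case: f => f1 f2; rewrite /pccmp /= !cmpf1. Qed.
Fact pccmpA x y z t (h : pchom z t) (g : pchom y z) (f : pchom x y) :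
  pccmp h (pccmp g f) = pccmp (pccmp h g) f.
Proof. by rewrite /pccmp /= !cmpA. Qed.
Definition prodc : category :=
  @Category pcobj pchom (fun x => (idc x.1, idc x.2)) pccmp
    pccmp1f pccmpf1 pccmpA.
End ProdCat.

(* The full subcategory of C on the object x, i.e. its monoid of
   endomorphisms; a module over it is a representation of that monoid. *)
Definition full1 (C : category) (x : C) : category :=
  @Category unit (fun _ _ => arr x x) (fun _ => idc x)
    (fun _ _ _ g f => cmp g f) (fun _ _ f => cmp1f f) (fun _ _ f => cmpf1 f)
    (fun _ _ _ _ h g f => cmpA h g f).

Definition surjectiveb (S T : finType) (f : S -> T) : bool :=
  [forall t, t \in codom f].

Lemma surjectiveP (S T : finType) (f : S -> T) :
  reflect (forall t, exists s, f s = t) (surjectiveb f).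
Proof.
apply: (iffP forallP) => H t.
  by have /codomP [s ->] := H t; exists s.
by have [s <-] := H t; apply: codom_f.
Qed.

Definition surj (S T : finType) := {f : {ffun S -> T} | surjectiveb f}.
Definition bij (S T : finType) :=
  {f : {ffun S -> T} | injectiveb f && surjectiveb f}.

Definition Surj (S T : finType) (f : {ffun S -> T}) (h : surjectiveb f) :
  surj S T := @exist _ (fun f : {ffun S -> T} => surjectiveb f) f h.
Definition Bij (S T : finType) (f : {ffun S -> T})
    (h : injectiveb f && surjectiveb f) : bij S T :=
  @exist _ (fun f : {ffun S -> T} => injectiveb f && surjectiveb f) f h.

Definition compff (S T R : finType) (g : T -> R) (f : S -> T) : {ffun S -> R} :=
  [ffun s => g (f s)].

Section SurjBij.
Implicit Types S T R : finType.

Fact idff_surj S : surjectiveb ([ffun s => s] : {ffun S -> S}).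
Proof. by apply/surjectiveP => s; exists s; rewrite ffunE. Qed.

Fact compff_surj S T R (g : T -> R) (f : S -> T) :
  surjectiveb g -> surjectiveb f -> surjectiveb (compff g f).
Proof.
move=> /surjectiveP gS /surjectiveP fS; apply/surjectiveP => r.
by have [t <-] := gS r; have [s <-] := fS t; exists s; rewrite ffunE.
Qed.

Definition surj_id S : surj S S := Surj (idff_surj S).
Definition surj_comp S T R (g : surj T R) (f : surj S T) : surj S R :=
  Surj (compff_surj (proj2_sig g) (proj2_sig f)).

Fact idff_bij S :
  injectiveb ([ffun s => s] : {ffun S -> S}) &&
  surjectiveb ([ffun s => s] : {ffun S -> S}).
Proof.
by rewrite idff_surj andbT; apply/injectiveP => x y; rewrite !ffunE.
Qed.

Fact compff_bij S T R (g : T -> R) (f : S -> T) :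
  injectiveb g && surjectiveb g -> injectiveb f && surjectiveb f ->
  injectiveb (compff g f) && surjectiveb (compff g f).
Proof.
move=> /andP[/injectiveP gI gS] /andP[/injectiveP fI fS].
rewrite compff_surj // andbT; apply/injectiveP => x y.
by rewrite !ffunE => /gI /fI.
Qed.

Definition bij_id S : bij S S := Bij (idff_bij S).
Definition bij_comp S T R (g : bij T R) (f : bij S T) : bij S R :=
  Bij (compff_bij (proj2_sig g) (proj2_sig f)).

Lemma bij_inj S T (f : bij S T) : injective (sval f).
Proof. by case/andP: (proj2_sig f) => /injectiveP. Qed.

Fact bij_surjb S T (f : bij S T) : surjectiveb (sval f).
Proof. by case/andP: (proj2_sig f). Qed.
Definition surj_of_bij S T (f : bij S T) : surj S T := Surj (bij_surjb f).

Lemma bij_card S T (f : bij S T) : #|S| = #|T|.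
Proof.
apply/eqP; rewrite eqn_leq (leq_card _ (@bij_inj _ _ f)) /=.
have /surjectiveP fS := bij_surjb f.
have gP t : {s | sval f s == t} by apply: sigW; have [s <-] := fS t; exists s.
apply: (@leq_card _ _ (fun t => sval (gP t))) => t u e.
by rewrite -(eqP (proj2_sig (gP t))) -(eqP (proj2_sig (gP u))) e.
Qed.

Fact surj_comp1f S T (f : surj S T) : surj_comp (surj_id T) f = f.
Proof. by apply: val_inj; apply/ffunP => x /=; rewrite !ffunE. Qed.
Fact surj_compf1 S T (f : surj S T) : surj_comp f (surj_id S) = f.
Proof. by apply: val_inj; apply/ffunP => x /=; rewrite !ffunE. Qed.
Fact surj_compA S T R Q (h : surj R Q) (g : surj T R) (f : surj S T) :
  surj_comp h (surj_comp g f) = surj_comp (surj_comp h g) f.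
Proof. by apply: val_inj; apply/ffunP => x /=; rewrite !ffunE. Qed.
Fact bij_comp1f S T (f : bij S T) : bij_comp (bij_id T) f = f.
Proof. by apply: val_inj; apply/ffunP => x /=; rewrite !ffunE. Qed.
Fact bij_compf1 S T (f : bij S T) : bij_comp f (bij_id S) = f.
Proof. by apply: val_inj; apply/ffunP => x /=; rewrite !ffunE. Qed.
Fact bij_compA S T R Q (h : bij R Q) (g : bij T R) (f : bij S T) :
  bij_comp h (bij_comp g f) = bij_comp (bij_comp h g) f.
Proof. by apply: val_inj; apply/ffunP => x /=; rewrite !ffunE. Qed.
End SurjBij.

Definition FS : category :=
  Category surj_comp1f surj_compf1 surj_compA.
Definition FB : category :=
  Category bij_comp1f bij_compf1 bij_compA.

Lemma linfunE (k : fieldType) (V W : vectType k) (f : V -> W) :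
  linear f -> linfun f =1 f.
Proof.
move=> fL; pose fLM := GRing.isLinear.Build k V W _ f fL.
pose fL' : {linear V -> W} := HB.pack f fLM.
exact: (lfunE fL').
Qed.

Section Kfree.
Variable k : fieldType.
Implicit Types (T : finType) (W : vectType k).

Definition kfree (T : finType) : vectType k := {ffun T -> k^o}.

Definition kbasis (T : finType) (t : T) : kfree T := [ffun s => (s == t)%:R].

(* The linear map sending each basis element [t] to phi t. *)
Definition kext (T : finType) (W : vectType k) (phi : T -> W) :
  'Hom(kfree T, W) :=
  linfun (fun x : kfree T => \sum_t (x t : k) *: phi t).

Lemma kextE T W (phi : T -> W) x : kext phi x = \sum_t (x t : k) *: phi t.
Proof.
rewrite linfunE // => a u v; rewrite scaler_sumr -big_split /=.
by apply: eq_bigr => t _; rewrite !ffunE scalerDl scalerA.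
Qed.

Lemma kext_basis T W (phi : T -> W) t : kext phi (kbasis t) = phi t.
Proof.
rewrite kextE (bigD1 t) //= ffunE eqxx scale1r big1 ?addr0 // => s /negPf nst.
by rewrite ffunE nst scale0r.
Qed.

Lemma kbasis_sum T (x : kfree T) : x = \sum_t (x t : k) *: kbasis t.
Proof.
apply/ffunP => s; rewrite sum_ffunE (bigD1 s) //= big1 => [|t /negPf nts].
  by rewrite !ffunE eqxx addr0 [RHS]mulr1.
by rewrite !ffunE eq_sym nts [LHS]mulr0.
Qed.

Lemma eq_kfree T (W : vectType k) (f g : 'Hom(kfree T, W)) :
  (forall t, f (kbasis t) = g (kbasis t)) -> f =1 g.
Proof.
move=> fg x; rewrite [x]kbasis_sum !linear_sum /=.
by apply: eq_bigr => t _; rewrite !linearZ /= fg.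
Qed.
End Kfree.
Arguments kbasis k {T} t.

(* V (x) W is modelled in coordinates: the elementary tensor v (x) w is the
   rank one matrix of the products of the coordinates of v and of w. *)
Section Tensor.
Variable k : fieldType.
Implicit Types V W : vectType k.

Definition tens (V W : vectType k) : vectType k := 'M[k]_(dim V, dim W).

Definition ptens (V W : vectType k) (v : V) (w : W) : tens V W :=
  (v2r v)^T *m v2r w.

Definition tensmap (V V' W W' : vectType k) (f : 'Hom(V, V'))
    (g : 'Hom(W, W')) : 'Hom(tens V W, tens V' W') :=
  linfun (fun x : tens V W => (f2mx f)^T *m x *m f2mx g : tens V' W').

Lemma tensmapE V V' W W' (f : 'Hom(V, V')) (g : 'Hom(W, W')) (x : tens V W) :
  tensmap f g x = (f2mx f)^T *m x *m f2mx g.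
Proof.
by rewrite linfunE // => a u v; rewrite mulmxDr mulmxDl -scalemxAr -scalemxAl.
Qed.

Lemma v2r_lfun (V W : vectType k) (f : 'Hom(V, W)) v :
  v2r (f v) = v2r v *m f2mx f.
Proof. by rewrite unlock /= r2vK. Qed.

Lemma tensmap_ptens V V' W W' (f : 'Hom(V, V')) (g : 'Hom(W, W')) v w :
  tensmap f g (ptens v w) = ptens (f v) (g w).
Proof. by rewrite tensmapE /ptens !v2r_lfun trmx_mul !mulmxA. Qed.

Lemma f2mx_id (V : vectType k) (f : 'Hom(V, V)) :
  (forall v, f v = v) -> f2mx f = 1%:M.
Proof.
move=> fE; apply/row_matrixP => i; rewrite !rowE mulmx1.
by rewrite -[delta_mx 0 i]r2vK -v2r_lfun fE.
Qed.

Lemma f2mx_comp (U V W : vectType k) (h : 'Hom(U, W)) (g : 'Hom(V, W))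
    (f : 'Hom(U, V)) :
  (forall v, h v = g (f v)) -> f2mx h = f2mx f *m f2mx g.
Proof.
move=> hE; apply/row_matrixP => i; rewrite !rowE mulmxA.
by rewrite -[delta_mx 0 i]r2vK -!v2r_lfun hE.
Qed.

Lemma tensmap_id V W (f : 'Hom(V, V)) (g : 'Hom(W, W)) x :
  (forall v, f v = v) -> (forall w, g w = w) -> tensmap f g x = x.
Proof.
by move=> fE gE; rewrite tensmapE !f2mx_id // trmx1 mul1mx mulmx1.
Qed.

Lemma tensmap_comp V V' V'' W W' W'' (f : 'Hom(V, V')) (f' : 'Hom(V', V''))
    (g : 'Hom(W, W')) (g' : 'Hom(W', W'')) (h : 'Hom(V, V''))
    (l : 'Hom(W, W'')) x :
  (forall v, h v = f' (f v)) -> (forall w, l w = g' (g w)) ->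
  tensmap h l x = tensmap f' g' (tensmap f g x).
Proof.
move=> hE lE; rewrite !tensmapE (f2mx_comp hE) (f2mx_comp lE).
by rewrite trmx_mul !mulmxA.
Qed.
End Tensor.

Section DirectSum.
Variables (k : fieldType) (I : finType) (V : I -> vectType k).

Definition dsum := {dffun forall i, V i}.
HB.instance Definition _ := Choice.on dsum.

Definition dsum_mk (f : forall i, V i) : dsum := finfun f.
Lemma dsum_mkE f i : dsum_mk f i = f i. Proof. by rewrite ffunE. Qed.
Lemma dsumP (x y : dsum) : (forall i, x i = y i) <-> x = y.
Proof. exact: ffunP. Qed.

Let add (x y : dsum) := dsum_mk (fun i => x i + y i).
Let opp (x : dsum) := dsum_mk (fun i => - x i).
Let scale (a : k) (x : dsum) := dsum_mk (fun i => a *: x i).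

Fact dsum_addA : associative add.
Proof. by move=> x y z; apply/dsumP => i; rewrite !dsum_mkE addrA. Qed.
Fact dsum_addC : commutative add.
Proof. by move=> x y; apply/dsumP => i; rewrite !dsum_mkE addrC. Qed.
Fact dsum_add0 : left_id (dsum_mk (fun=> 0)) add.
Proof. by move=> x; apply/dsumP => i; rewrite !dsum_mkE add0r. Qed.
Fact dsum_addN : left_inverse (dsum_mk (fun=> 0)) opp add.
Proof. by move=> x; apply/dsumP => i; rewrite !dsum_mkE addNr. Qed.
HB.instance Definition _ :=
  GRing.isZmodule.Build dsum dsum_addA dsum_addC dsum_add0 dsum_addN.

Fact dsum_scaleA a b x : scale a (scale b x) = scale (a * b) x.
Proof. by apply/dsumP => i; rewrite !dsum_mkE scalerA. Qed.
Fact dsum_scale1 : left_id 1 scale.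
Proof. by move=> x; apply/dsumP => i; rewrite !dsum_mkE scale1r. Qed.
Fact dsum_scaleDr : right_distributive scale +%R.
Proof. by move=> a x y; apply/dsumP => i; rewrite !dsum_mkE scalerDr. Qed.
Fact dsum_scaleDl x : {morph scale^~ x : a b / a + b}.
Proof. by move=> a b; apply/dsumP => i; rewrite !dsum_mkE scalerDl. Qed.
HB.instance Definition _ :=
  GRing.Zmodule_isLmodule.Build k dsum
    dsum_scaleA dsum_scale1 dsum_scaleDr dsum_scaleDl.

Let dsumDE0 (x y : dsum) i : (x + y) i = x i + y i.
Proof. exact: dsum_mkE. Qed.
Let dsumZE0 a (x : dsum) i : (a *: x) i = a *: x i.
Proof. exact: dsum_mkE. Qed.

Let J : finType := {i : I & 'I_(dim (V i))}.
Fact dsum_vect_iso : Vector.axiom #|J| dsum.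
Proof.
exists (fun x : dsum => \row_j v2r (x (tag (enum_val j))) 0 (tagged (enum_val j))).
  move=> a x y; apply/rowP => j; rewrite !mxE dsumDE0 dsumZE0.
  by rewrite linearP !mxE.
exists (fun r : 'rV_#|J| =>
  dsum_mk (fun i => r2v (\row_a r 0 (enum_rank (Tagged _ a : J))))) => [x|r].
  apply/dsumP => i; rewrite dsum_mkE -[RHS]v2rK; congr r2v.
  by apply/rowP => a; rewrite !mxE enum_rankK.
apply/rowP => j; rewrite !mxE dsum_mkE r2vK mxE -[in RHS](enum_valK j).
by congr (r 0 (enum_rank _)); case: (enum_val j).
Qed.
HB.instance Definition _ := Lmodule_hasFinDim.Build k dsum dsum_vect_iso.
End DirectSum.

Lemma dsumDE (k : fieldType) (I : finType) (V : I -> vectType k)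
    (x y : (dsum V : vectType k)) i :
  (x + y : dsum V) i = (x : dsum V) i + (y : dsum V) i.
Proof. exact: dsum_mkE. Qed.

Lemma dsumZE (k : fieldType) (I : finType) (V : I -> vectType k) (a : k)
    (x : (dsum V : vectType k)) i :
  (a *: x : dsum V) i = a *: (x : dsum V) i.
Proof. exact: dsum_mkE. Qed.

Section DsumMap.
Variables (k : fieldType) (I J : finType) (V : I -> vectType k).
Variables (W : J -> vectType k) (s : J -> I).
Variable phi : forall j, 'Hom(V (s j), W j).

Definition dsum_map : 'Hom(dsum V, dsum W) :=
  linfun (fun x : dsum V => dsum_mk (fun j => phi j (x (s j)))).

Lemma dsum_mapE (x : dsum V) j : (dsum_map x : dsum W) j = phi j (x (s j)).
Proof.
rewrite linfunE ?dsum_mkE // => a u w; apply/dsumP => i.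
by rewrite (dsumDE (V := W)) (dsumZE (V := W)) 3!dsum_mkE (dsumDE (V := V)) (dsumZE (V := V)) linearP.
Qed.
End DsumMap.

(* A functor from C to vector spaces is the same thing as a k-linear functor
   from the k-linearization of C, and k(C x D) = kC (x) kD. Values are finite
   dimensional, as required by vectType. *)
Record module (k : fieldType) (C : category) := Module {
  mobj :> C -> vectType k;
  mact : forall x y : C, arr x y -> 'Hom(mobj x, mobj y);
  mact1 : forall x v, mact (idc x) v = v;
  mactM : forall x y z (g : arr y z) (f : arr x y) v,
    mact (cmp g f) v = mact g (mact f v)
}.
Arguments mact {k C} m {x y} f.

Record modmor (k : fieldType) (C : category) (M N : module k C) := Modmor {
  mmap :> forall x : C, 'Hom(M x, N x);
  mmap_nat : forall x y (f : arr x y) v,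
    mmap y (mact M f v) = mact N f (mmap x v)
}.

Definition short_exact (k : fieldType) (C : category)
    (M' M M'' : module k C) : Prop :=
  exists (a : modmor M' M) (b : modmor M M''), forall x : C,
    [/\ lker (a x) = 0%VS, limg (a x) = lker (b x) & limg (b x) = fullv].

Section K0.
Variables (k : fieldType) (C : category).

(* The Grothendieck group of C-modules, presented as an abelian group by the
   generators [M] and the relations [M] = [M'] + [M''] for short exact
   sequences: K0 is the type of words, and K0eq is equality in the group. *)
Inductive K0 : Type :=
| K0cls of module k C
| K0zero
| K0add of K0 & K0
| K0opp of K0.

Inductive K0eq : K0 -> K0 -> Prop :=
| K0eq_refl x : K0eq x x
| K0eq_sym x y : K0eq x y -> K0eq y x
| K0eq_trans x y z : K0eq x y -> K0eq y z -> K0eq x z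
| K0eq_add x x' y y' : K0eq x x' -> K0eq y y' -> K0eq (K0add x y) (K0add x' y')
| K0eq_opp x x' : K0eq x x' -> K0eq (K0opp x) (K0opp x')
| K0eq_addA x y z : K0eq (K0add x (K0add y z)) (K0add (K0add x y) z)
| K0eq_addC x y : K0eq (K0add x y) (K0add y x)
| K0eq_add0 x : K0eq (K0add K0zero x) x
| K0eq_addN x : K0eq (K0add (K0opp x) x) K0zero
| K0eq_ses M' M M'' : short_exact M' M M'' ->
    K0eq (K0cls M) (K0add (K0cls M') (K0cls M'')).

(* (-1)^n x *)
Definition K0sgn (n : nat) (x : K0) : K0 := if odd n then K0opp x else x.

Definition K0sum (I : Type) (r : seq I) (c : I -> K0) : K0 :=
  foldr (fun i => K0add (c i)) K0zero r.
End K0.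
Arguments K0zero {k C}.

Declare Scope K0_scope.
Delimit Scope K0_scope with K0.
Bind Scope K0_scope with K0.
Notation "[ 'cls' M ]" := (K0cls M) (at level 0, format "[ 'cls'  M ]") : K0_scope.
Notation "x + y" := (K0add x y) : K0_scope.
Notation "- x" := (K0opp x) : K0_scope.
Notation "0" := K0zero : K0_scope.
Notation "x =K0 y" := (K0eq x y) (at level 70, no associativity) : K0_scope.

Section Evaluation.
Variables (k : fieldType) (C : category) (x : C).

Definition ev_mod (M : module k C) : module k (full1 x) :=
  @Module k (full1 x) (fun _ => M x) (fun _ _ f => mact M f)
    (fun _ => @mact1 _ _ M x)
    (fun _ _ _ => @mactM _ _ M x x x).

Fixpoint ev (u : K0 k C) : K0 k (full1 x) :=
  match u with
  | K0cls M => K0cls (ev_mod M)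
  | K0zero => K0zero
  | K0add u v => K0add (ev u) (ev v)
  | K0opp u => K0opp (ev u)
  end.

Lemma ev_compat u v : K0eq u v -> K0eq (ev u) (ev v).
Proof.
elim=> {u v} /=; [by move=> *; apply: K0eq_refl | by move=> *; apply: K0eq_sym
  | by move=> *; apply: K0eq_trans; eauto | by move=> *; apply: K0eq_add
  | by move=> *; apply: K0eq_opp | by move=> *; apply: K0eq_addA
  | by move=> *; apply: K0eq_addC | by move=> *; apply: K0eq_add0
  | by move=> *; apply: K0eq_addN | ].
move=> M' M M'' [a [b ab]]; apply: K0eq_ses.
pose a' := @Modmor k _ (ev_mod M') (ev_mod M) (fun _ => a x)
  (fun _ _ => @mmap_nat _ _ _ _ a x x).
pose b' := @Modmor k _ (ev_mod M) (ev_mod M'') (fun _ => b x)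
  (fun _ _ => @mmap_nat _ _ _ _ b x x).
by exists a', b' => -[]; apply: ab.
Qed.

(* s is the value at x of the infinite sum of the classes c i, all but
   finitely many of which vanish at x. It is unique, see is_sum_at_unique. *)
Definition is_sum_at (I : eqType) (c : I -> K0 k C) (s : K0 k (full1 x)) :=
  exists r : seq I,
    [/\ uniq r, forall i, i \notin r -> K0eq (ev (c i)) K0zero
      & K0eq s (K0sum r (fun i => ev (c i)))].
End Evaluation.

Section Submodule.
Variables (k : fieldType) (C : category) (M : module k C).
Variable W : forall x : C, {vspace M x}.
Hypothesis Wact : forall x y (f : arr x y) v, v \in W x -> mact M f v \in W y.

Definition submod_act x y (f : arr x y) : 'Hom(subvs_of (W x), subvs_of (W y)) :=
  linfun (fun v : subvs_of (W x) => vsproj (W y) (mact M f (vsval v))).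

Lemma submod_actE x y (f : arr x y) v :
  vsval (submod_act f v) = mact M f (vsval v).
Proof.
rewrite linfunE ?vsprojK ?Wact ?subvsP // => a u w.
by rewrite !linearP.
Qed.

Fact submod_act1 x v : submod_act (idc x) v = v.
Proof. by apply: val_inj; rewrite /= submod_actE mact1. Qed.
Fact submod_actM x y z (g : arr y z) (f : arr x y) v :
  submod_act (cmp g f) v = submod_act g (submod_act f v).
Proof. by apply: val_inj; rewrite /= !submod_actE mactM. Qed.

Definition submod : module k C :=
  @Module k C (fun x => subvs_of (W x)) submod_act submod_act1 submod_actM.
End Submodule.

Section Box.
Variables (k : fieldType) (C D : category) (M : module k C) (N : module k D).

Definition box_obj (x : prodc C D) : vectType k := tens (M x.1) (N x.2).
Definition box_act (x y : prodc C D) (f : arr x y) :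
    'Hom(box_obj x, box_obj y) := tensmap (mact M f.1) (mact N f.2).
Fact box_act1 x v : box_act (idc x) v = v.
Proof. by apply: tensmap_id => w; apply: mact1. Qed.
Fact box_actM x y z (g : arr y z) (f : arr x y) v :
  box_act (cmp g f) v = box_act g (box_act f v).
Proof. by apply: tensmap_comp => w; apply: mactM. Qed.

Definition box : module k (prodc C D) := Module box_act1 box_actM.
End Box.

Notation FBop := (opc FB).
Notation FBFBop := (prodc FB FBop).

Section KFS.
Variable k : fieldType.

Definition kFS_obj (x : FBFBop) : vectType k := kfree k (surj x.2 x.1).

Definition kFS_act (x y : FBFBop) (f : arr x y) : 'Hom(kFS_obj x, kFS_obj y) :=
  kext (fun h : surj x.2 x.1 =>
    kbasis k (surj_comp (surj_of_bij f.1) (surj_comp h (surj_of_bij f.2)))).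

Fact kFS_act1 x v : kFS_act (idc x) v = v.
Proof.
rewrite -[RHS](id_lfunE v); apply: (@eq_kfree k) => h.
rewrite kext_basis id_lfunE; congr kbasis.
by apply: val_inj; apply/ffunP => u /=; rewrite !ffunE.
Qed.

Fact kFS_actM x y z (g : arr y z) (f : arr x y) v :
  kFS_act (cmp g f) v = kFS_act g (kFS_act f v).
Proof.
rewrite -[RHS]comp_lfunE; apply: (@eq_kfree k) => h.
rewrite comp_lfunE !kext_basis; congr kbasis.
by apply: val_inj; apply/ffunP => u /=; rewrite !ffunE.
Qed.

Definition kFS : module k FBFBop := Module kFS_act1 kFS_actM.

(* i^* : kFS(U,X) -> kFS(V,X) *)
Definition pull (U V X : finType) (i : {ffun V -> U}) :
    'Hom(kfree k (surj U X), kfree k (surj V X)) :=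
  kext (fun f : surj U X =>
    if insub (compff (sval f) i) is Some h then kbasis k (h : surj V X) else 0).

(* Up to bijection the source of i may be taken to be 'I_#|U|.-1;
   see kFS0P. *)
Definition kFS0_space (U X : finType) : {vspace kfree k (surj U X)} :=
  (\bigcap_(i : {ffun 'I_#|U|.-1 -> U} | (0 < #|U|)%N && injectiveb i)
     lker (pull X i))%VS.

Lemma pull_basis (U V X : finType) (i : {ffun V -> U}) (f : surj U X) :
  pull X i (kbasis k f) =
  if insub (compff (sval f) i) is Some h then kbasis k (h : surj V X) else 0.
Proof. exact: kext_basis. Qed.

Lemma pull_surj (U V X : finType) (i : {ffun V -> U}) (f : surj U X)
    (h : surjectiveb (compff (sval f) i)) :
  pull X i (kbasis k f) = kbasis k (Surj h).
Proof.
rewrite pull_basis insubT; congr kbasis; exact: val_inj.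
Qed.

Lemma pull_nsurj (U V X : finType) (i : {ffun V -> U}) (f : surj U X) :
  ~~ surjectiveb (compff (sval f) i) -> pull X i (kbasis k f) = 0.
Proof. by move=> h; rewrite pull_basis insubN. Qed.

Lemma compffA (S T R Q : finType) (h : {ffun R -> Q}) (g : {ffun T -> R})
  (f : {ffun S -> T}) : compff h (compff g f) = compff (compff h g) f.
Proof. by apply/ffunP => s; rewrite !ffunE. Qed.

Lemma surj_compl (S T R : finType) (g : T -> R) (f : S -> T) :
  surjectiveb (compff g f) -> surjectiveb g.
Proof.
move=> /surjectiveP gf; apply/surjectiveP => r.
by have [s <-] := gf r; exists (f s); rewrite ffunE.
Qed.

Lemma pull_comp (U V W X : finType) (i : {ffun V -> U}) (j : {ffun W -> V}) x :
  pull X (compff i j) x = pull X j (pull X i x).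
Proof.
rewrite -[RHS]comp_lfunE; apply: (@eq_kfree k) => f; rewrite comp_lfunE.
case: (boolP (surjectiveb (compff (sval f) i))) => fi; last first.
  rewrite [pull X i _]pull_nsurj // linear0 pull_nsurj //.
  by apply: contra fi; rewrite compffA => /surj_compl.
rewrite [pull X i _]pull_surj.
case: (boolP (surjectiveb (compff (sval f) (compff i j)))) => fij; last first.
  by rewrite !pull_nsurj //= -?compffA.
have fij' : surjectiveb (compff (sval (Surj fi)) j) by rewrite -compffA.
rewrite !pull_surj; congr kbasis; apply: val_inj; exact: compffA.
Qed.

Lemma pull_act (x y : FBFBop) (f : arr x y) (W : finType)
    (i : {ffun W -> y.2}) v :
  pull y.1 i (kFS_act f v) =
  @kFS_act (x.1, W) (y.1, W) (f.1, bij_id W)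
    (pull x.1 (compff (sval f.2) i) v).
Proof.
rewrite -[LHS]comp_lfunE -[RHS]comp_lfunE; apply: (@eq_kfree k) => h.
rewrite !comp_lfunE [kFS_act f _]kext_basis.
set fh := surj_comp _ _.
have fhE : compff (sval fh) i =
    compff (sval f.1) (compff (sval h) (compff (sval f.2) i)).
  by apply/ffunP => w; rewrite !ffunE.
case: (boolP (surjectiveb (compff (sval h) (compff (sval f.2) i)))) => hi.
  have fi : surjectiveb (compff (sval fh) i).
    by rewrite fhE compff_surj // bij_surjb.
  rewrite !pull_surj [RHS]kext_basis; congr kbasis; apply: val_inj.
  by rewrite /= fhE; apply/ffunP => w; rewrite !ffunE.
rewrite !pull_nsurj ?linear0 // fhE; apply: contra hi => /surjectiveP gS.
apply/surjectiveP => z; have [w] := gS (sval f.1 z).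
by rewrite ffunE => /bij_inj <-; exists w.
Qed.

Lemma kFS0P (U X : finType) (x : kfree k (surj U X)) :
  reflect (forall (V : finType) (i : {ffun V -> U}),
             injective i -> #|V|.+1 = #|U| -> pull X i x = 0)
          (x \in kFS0_space U X).
Proof.
rewrite /kFS0_space memvE; apply: (iffP subv_bigcapP) => [xP V i iI cV | xP i].
  have cV' : #|V| = #|U|.-1 by rewrite -cV.
  pose j : {ffun 'I_#|U|.-1 -> V} := [ffun a => enum_val (cast_ord (esym cV') a)].
  pose j' : {ffun V -> 'I_#|U|.-1} := [ffun v => cast_ord cV' (enum_rank v)].
  have -> : i = compff (compff i j) j'.
    by apply/ffunP => v; rewrite !ffunE cast_ordK enum_rankK.
  have U0 : (0 < #|U|)%N by rewrite -cV.
  have ijI : injectiveb (compff i j).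
    apply/injectiveP => a b.
    by rewrite !ffunE => /iI /enum_val_inj /cast_ord_inj.
  have := xP (compff i j); rewrite U0 ijI -memvE memv_ker => /(_ isT)/eqP xij.
  by rewrite pull_comp xij linear0.
case/andP => U0 /injectiveP iI; rewrite -memvE memv_ker; apply/eqP/xP => //.
by rewrite card_ord prednK.
Qed.

Fact kFS0_stable (x y : FBFBop) (f : arr x y) (v : kFS x) :
  v \in kFS0_space x.2 x.1 -> mact kFS f v \in kFS0_space y.2 y.1.
Proof.
move=> /kFS0P vP; apply/kFS0P => V i iI cV /=; rewrite pull_act vP ?linear0 //.
  by move=> a b; rewrite !ffunE => /bij_inj /iI.
by rewrite cV (bij_card f.2).
Qed.

Definition kFS0 : module k FBFBop := submod kFS0_stable.
End KFS.

Section Sign.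
Variable k : fieldType.
Implicit Types S T R : finType.

Definition enum_bij S T (e : #|S| = #|T|) (s : S) : T :=
  enum_val (cast_ord e (enum_rank s)).

Fact enum_bijK S T (e : #|S| = #|T|) (e' : #|T| = #|S|) :
  cancel (enum_bij e) (enum_bij e').
Proof.
move=> s; rewrite /enum_bij enum_valK; apply: (canLR enum_rankK).
exact: val_inj.
Qed.

Fact enum_bij_comp S T R (e : #|S| = #|T|) (e' : #|T| = #|R|)
    (e'' : #|S| = #|R|) s :
  enum_bij e' (enum_bij e s) = enum_bij e'' s.
Proof. by rewrite /enum_bij enum_valK; congr enum_val; apply: val_inj. Qed.

Lemma enum_bij_id S (e : #|S| = #|S|) s : enum_bij e s = s.
Proof.
by rewrite /enum_bij (_ : cast_ord e _ = enum_rank s) ?enum_rankK //; apply: val_inj.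
Qed.

Fact bij_perm_subproof S T (f : bij S T) :
  injective (fun s => enum_bij (esym (bij_card f)) (sval f s)).
Proof.
by move=> s s' /(can_inj (enum_bijK _ (bij_card f))) /bij_inj.
Qed.

Definition bij_perm S T (f : bij S T) : {perm S} := perm (@bij_perm_subproof S T f).

(* The sign of the bijection f : S -> T, where S and T are identified along
   their enumerations; for S = T this is the signature of f. *)
Definition bij_sign S T (f : bij S T) : k := (-1) ^+ bij_perm f.

Lemma bij_perm_aut S (f : bij S S) s : bij_perm f s = sval f s.
Proof. by rewrite permE enum_bij_id. Qed.

Lemma odd_perm_conj S T (h : S -> T) (h' : T -> S) (p : {perm S})
    (q : {perm T}) :
  cancel h h' -> cancel h' h -> (forall t, q t = h (p (h' t))) ->
  q = p :> bool.
Proof.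
move=> hK h'K; have [ts -> _] := prod_tpermP p.
elim: ts q => [|t ts IH] q qE.
  suff -> : q = 1%g by rewrite big_nil !odd_perm1.
  by apply/permP => x; rewrite qE big_nil !perm1 h'K.
have hI := can_inj hK.
have := IH (tperm (h t.1) (h t.2) * q)%g _.
rewrite big_cons !odd_permM !odd_tperm (inj_eq hI) => <-; first by rewrite addKb.
move=> x; rewrite permM qE big_cons permM; congr (h (_ _)).
suff -> : h' (tperm (h t.1) (h t.2) x) = tperm t.1 t.2 (h' x) by rewrite tpermK.
case: (tpermP t.1 t.2 (h' x)) => [<-|<-|].
- by rewrite h'K tpermL hK.
- by rewrite h'K tpermR hK.
move=> x1 x2; rewrite tpermD //; apply/eqP => hx.
  by apply: x1; rewrite -hx hK.
by apply: x2; rewrite -hx hK.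
Qed.

Lemma bij_sign1 S : bij_sign (bij_id S) = 1.
Proof.
rewrite /bij_sign (_ : bij_perm _ = 1%g) ?odd_perm1 //.
by apply/permP => s; rewrite bij_perm_aut /= ffunE perm1.
Qed.

Lemma bij_signM S T R (g : bij T R) (f : bij S T) :
  bij_sign (bij_comp g f) = bij_sign g * bij_sign f.
Proof.
have eST := bij_card f; have eTR := bij_card g.
pose q := ((bij_perm f)^-1 * bij_perm (bij_comp g f))%g.
have fqE : bij_perm (bij_comp g f) = (bij_perm f * q)%g by rewrite mulKVg.
rewrite /bij_sign fqE odd_permM signr_addb mulrC; congr (_ * _).
rewrite (@odd_perm_conj _ _ (enum_bij (esym eST)) (enum_bij eST) (bij_perm g)) //.
- exact: enum_bijK.
- exact: enum_bijK.
move=> s; rewrite /q permM.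
set s' := ((bij_perm f)^-1)%g s.
have -> : s = bij_perm f s' by rewrite permKV.
rewrite !permE /= !ffunE enum_bijK; symmetry.
exact: enum_bij_comp.
Qed.

End Sign.
Section SignModules.
Variables (k : fieldType) (t : nat).
Implicit Types S T R : finType.

(* A line if #|S| = t, and 0 otherwise. *)
Definition sgn_obj (S : finType) : vectType k := 'rV[k]_(#|S| == t).

Definition sgn_act (S T : finType) (c : k) : 'Hom(sgn_obj S, sgn_obj T) :=
  linfun (fun v : sgn_obj S => const_mx (c * \sum_i v 0 i) : sgn_obj T).

Lemma sgn_actE S T (c : k) v :
  sgn_act S T c v = const_mx (c * \sum_i v 0 i) :> 'rV_(#|T| == t).
Proof.
rewrite linfunE // => a u w; apply/rowP => j; rewrite !mxE mulrCA -mulrDr.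
by congr (_ * _); rewrite mulr_sumr -big_split; apply: eq_bigr => i _; rewrite !mxE.
Qed.

Lemma sgn_act_id S v : sgn_act S S 1 v = v.
Proof.
rewrite sgn_actE mul1r; apply/rowP; rewrite /sgn_obj in v *.
move: v; case: (#|S| == t) => /= v i; last by case: i.
by rewrite mxE big_ord1 !ord1.
Qed.

Lemma sgn_act_comp S T R (c d : k) v :
  #|S| = #|T| -> sgn_act S R (d * c) v = sgn_act T R d (sgn_act S T c v).
Proof.
move=> eST; rewrite !sgn_actE; congr const_mx; rewrite -mulrA; congr (_ * _).
rewrite /sgn_obj in v *; move: v; rewrite -eST.
case: (#|S| == t) => v; last by rewrite !big_ord0 mulr0.
by rewrite [RHS]big_ord1 mxE.
Qed.

Fact sgn1 (S : FB) v : sgn_act S S (bij_sign k (idc S)) v = v.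
Proof. by rewrite bij_sign1 sgn_act_id. Qed.
Fact sgnM (S T R : FB) (g : arr T R) (f : arr S T) v :
  sgn_act S R (bij_sign k (cmp g f)) v =
  sgn_act T R (bij_sign k g) (sgn_act S T (bij_sign k f) v).
Proof. by rewrite bij_signM (sgn_act_comp R _ _ _ (bij_card f)). Qed.

Definition sgn : module k FB :=
  @Module k FB sgn_obj (fun S T f => sgn_act S T (bij_sign k f)) sgn1 sgnM.

Fact sgnop1 (S : FBop) v : sgn_act S S (bij_sign k (idc S)) v = v.
Proof. exact: sgn1. Qed.
Fact sgnopM (S T R : FBop) (g : arr T R) (f : arr S T) v :
  sgn_act S R (bij_sign k (cmp g f)) v =
  sgn_act T R (bij_sign k g) (sgn_act S T (bij_sign k f) v).
Proof.
by rewrite bij_signM mulrC (sgn_act_comp R _ _ _ (esym (bij_card f))).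
Qed.

Definition sgnop : module k FBop :=
  @Module k FBop sgn_obj (fun S T f => sgn_act S T (bij_sign k f)) sgnop1 sgnopM.
End SignModules.

Definition subs (U : finType) (A : {set U}) : finType := {u : U | u \in A}.

Section Restrict.
Variables (V U : finType) (s : bij V U) (B : {set V}) (A : {set U}).
Hypothesis sBA : forall v, (v \in B) = (sval s v \in A).

Fact restr_subproof (b : subs B) : sval s (sval b) \in A.
Proof. by rewrite -sBA; apply: (svalP b). Qed.
Definition restr_fun : {ffun subs B -> subs A} :=
  [ffun b => exist (fun u => u \in A) _ (restr_subproof b)].
Fact restr_bij : injectiveb restr_fun && surjectiveb restr_fun.
Proof.
apply/andP; split; [apply/injectiveP => b b' | apply/surjectiveP => a].
  rewrite !ffunE => /(congr1 sval) /= /bij_inj; exact: val_inj.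
have /surjectiveP/(_ (sval a)) [v va] := bij_surjb s.
have vB : v \in B by rewrite sBA va; apply: (svalP a).
exists (exist (fun u => u \in B) v vB); rewrite ffunE; exact: val_inj.
Qed.
Definition restr : bij (subs B) (subs A) := Bij restr_bij.
End Restrict.

Lemma restrE (V U : finType) (s : bij V U) (B : {set V}) (A : {set U})
    (h : forall v, (v \in B) = (sval s v \in A)) b :
  sval (sval (restr h) b) = sval s (sval b).
Proof. by rewrite ffunE. Qed.

Lemma restr_irr (V U : finType) (s : bij V U) (B : {set V}) (A : {set U})
    (h h' : forall v, (v \in B) = (sval s v \in A)) : restr h = restr h'.
Proof.
by apply: val_inj; apply/ffunP => b /=; rewrite !ffunE; apply: val_inj.
Qed.

Lemma mem_bij_imset (V U : finType) (s : bij V U) (B : {set V}) v :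
  (v \in B) = (sval s v \in sval s @: B).
Proof. by rewrite mem_imset //; apply: bij_inj. Qed.

Lemma mem_bij_imsetC (V U : finType) (s : bij V U) (B : {set V}) v :
  (v \in ~: B) = (sval s v \in ~: (sval s @: B)).
Proof. by rewrite !inE -mem_bij_imset. Qed.

Section Day.
Variables (k : fieldType) (M : module k FBFBop) (N : module k FBop).

(* The decomposition of x.2 into A and ~: A contributes M(A) (x) N(~: A). *)
Definition day_comp (x : FBFBop) (A : {set x.2}) : vectType k :=
  tens (M (x.1, subs A)) (N (subs (~: A))).
Definition day_obj (x : FBFBop) : vectType k := dsum (@day_comp x).

Definition day_comp_act (x y : FBFBop) (f : arr x y) (B : {set y.2})
    (A : {set x.2}) (h : forall v, (v \in B) = (sval f.2 v \in A))
    (h' : forall v, (v \in ~: B) = (sval f.2 v \in ~: A)) :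
    'Hom(day_comp A, day_comp B) :=
  tensmap
    (@mact _ _ M (x.1, subs A) (y.1, subs B) (f.1, restr h))
    (@mact _ _ N (subs (~: A)) (subs (~: B)) (restr h')).

Definition day_act (x y : FBFBop) (f : arr x y) : 'Hom(day_obj x, day_obj y) :=
  dsum_map (fun B : {set y.2} =>
    day_comp_act (mem_bij_imset f.2 B) (mem_bij_imsetC f.2 B)).

Lemma day_actE x y (f : arr x y) (v : day_obj x) (B : {set y.2}) (A : {set x.2})
    (h : forall v, (v \in B) = (sval f.2 v \in A))
    (h' : forall v, (v \in ~: B) = (sval f.2 v \in ~: A)) :
  (day_act f v : dsum _) B = day_comp_act h h' (v A).
Proof.
rewrite dsum_mapE.
have eA : sval f.2 @: B = A.
  apply/setP => u; have /surjectiveP/(_ u) [z <-] := bij_surjb f.2.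
  by rewrite -mem_bij_imset h.
case: _ / eA in h h' *.
rewrite /day_comp_act (restr_irr h (mem_bij_imset f.2 B)).
by rewrite (restr_irr h' (mem_bij_imsetC f.2 B)).
Qed.

Fact day_act1 x v : day_act (idc x) v = v.
Proof.
apply/dsumP => A.
have h (B : {set x.2}) u : (u \in B) = (sval (idc x).2 u \in B) by rewrite ffunE.
rewrite (day_actE _ (h A) (h (~: A))) /day_comp_act.
have rE (B : {set x.2}) : restr (h B) = bij_id (subs B).
  by apply: val_inj; apply/ffunP => u; apply: val_inj;
  rewrite [LHS]restrE ffunE [in RHS]ffunE.
rewrite !rE; apply: tensmap_id => w; [exact: (mact1 (m := M)) | exact: mact1].
Qed.

Fact day_actM x y z (g : arr y z) (f : arr x y) v :
  day_act (cmp g f) v = day_act g (day_act f v).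
Proof.
apply/dsumP => B.
have gB := mem_bij_imset g.2 B; have gB' := mem_bij_imsetC g.2 B.
set A := sval g.2 @: B in gB gB' *.
have fA := mem_bij_imset f.2 A; have fA' := mem_bij_imsetC f.2 A.
have h u : (u \in B) = (sval (cmp g f).2 u \in sval f.2 @: A).
  by rewrite ffunE -fA -gB.
have h' u : (u \in ~: B) = (sval (cmp g f).2 u \in ~: (sval f.2 @: A)).
  by rewrite ffunE -fA' -gB'.
rewrite (day_actE _ h h') (day_actE _ gB gB') (day_actE _ fA fA').
apply: tensmap_comp => w; rewrite -mactM; congr (mact _ _ _); [congr pair|];
  by apply: val_inj; apply/ffunP => u /=; rewrite !ffunE; apply: val_inj;
     rewrite /= !ffunE.
Qed.

Definition day : module k FBFBop := Module day_act1 day_actM.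
End Day.

Section DayK0.
Variable k : fieldType.

(* The biadditive extension of [M] (.) [N] = [M (.) N] to words; it respects
   equality in K0, see dayK0_compat. *)
Fixpoint dayK0_cls (M : module k FBFBop) (v : K0 k FBop) : K0 k FBFBop :=
  match v with
  | K0cls N => K0cls (day M N)
  | K0zero => K0zero
  | K0add v w => K0add (dayK0_cls M v) (dayK0_cls M w)
  | K0opp v => K0opp (dayK0_cls M v)
  end.

Fixpoint dayK0 (u : K0 k FBFBop) (v : K0 k FBop) : K0 k FBFBop :=
  match u with
  | K0cls M => dayK0_cls M v
  | K0zero => K0zero
  | K0add u w => K0add (dayK0 u v) (dayK0 w v)
  | K0opp u => K0opp (dayK0 u v)
  end.
End DayK0.

Notation "u ⊙ v" := (dayK0 u v) (at level 40, left associativity) : K0_scope.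
Section Exactness.
Variable k : fieldType.
Implicit Types U V W Z : vectType k.

Definition exact3 U V W (a : 'Hom(U, V)) (b : 'Hom(V, W)) : Prop :=
  [/\ lker a = 0%VS, limg a = lker b & limg b = fullv].

Definition split3 U V W (a : 'Hom(U, V)) (b : 'Hom(V, W)) : Prop :=
  exists (r : 'Hom(V, U)) (s : 'Hom(W, V)),
    [/\ forall u, b (a u) = 0, forall u, r (a u) = u, forall w, b (s w) = w
      & forall v, v = a (r v) + s (b v)].

Lemma exact3_splitting U V W (a : 'Hom(U, V)) (b : 'Hom(V, W)) :
  let r := (a^-1 \o (\1%VF - (b^-1 \o b)%VF)%R)%VF in
  exact3 a b ->
  [/\ forall u, b (a u) = 0, forall u, r (a u) = u,
      forall w, b ((b^-1)%VF w) = w & forall v, v = a (r v) + (b^-1)%VF (b v)].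
Proof.
move=> r [/eqP a0 ab bT].
have bs w : b ((b^-1)%VF w) = w by rewrite limg_lfunVK // bT memvf.
have ba u : b (a u) = 0 by apply/eqP; rewrite -memv_ker -ab memv_img ?memvf.
have rE v : r v = (a^-1)%VF (v - (b^-1)%VF (b v)).
  by rewrite comp_lfunE add_lfunE opp_lfunE comp_lfunE id_lfunE.
split=> // [u|v].
  by rewrite rE ba linear0 subr0 lker0_lfunK.
by rewrite rE limg_lfunVK ?subrK // ab memv_ker linearB /= bs subrr.
Qed.

Lemma split3_exact U V W (a : 'Hom(U, V)) (b : 'Hom(V, W)) :
  split3 a b -> exact3 a b.
Proof.
move=> [r [s [ba ra bs E]]]; split.
- apply/eqP; rewrite -subv0; apply/subvP => u; rewrite memv_ker => /eqP au.
  by rewrite -(ra u) au linear0 mem0v.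
- apply/eqP; rewrite eqEsubv; apply/andP; split; apply/subvP => v.
    by case/memv_imgP => u _ ->; rewrite memv_ker ba.
  by rewrite memv_ker => /eqP bv; rewrite (E v) bv linear0 addr0 memv_img ?memvf.
- apply/eqP; rewrite eqEsubv subvf; apply/subvP => w _.
  by rewrite -(bs w) memv_img ?memvf.
Qed.

Lemma exact3_split U V W (a : 'Hom(U, V)) (b : 'Hom(V, W)) :
  exact3 a b -> split3 a b.
Proof. by move=> /exact3_splitting ab; eexists; eexists; exact: ab. Qed.

Lemma split3_f2mx U V W (a : 'Hom(U, V)) (b : 'Hom(V, W))
    (r : 'Hom(V, U)) (s : 'Hom(W, V)) :
  [/\ forall u, b (a u) = 0, forall u, r (a u) = u, forall w, b (s w) = w
    & forall v, v = a (r v) + s (b v)] ->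
  [/\ f2mx a *m f2mx b = 0, f2mx a *m f2mx r = 1%:M, f2mx s *m f2mx b = 1%:M
    & f2mx r *m f2mx a + f2mx b *m f2mx s = 1%:M].
Proof.
case=> ba ra bs E; split.
- apply/row_matrixP => i; rewrite !rowE mulmxA.
  by rewrite -[delta_mx 0 i]r2vK -!v2r_lfun ba linear0 mulmx0.
- apply/row_matrixP => i; rewrite !rowE mulmxA.
  by rewrite -[delta_mx 0 i]r2vK -!v2r_lfun ra mulmx1.
- apply/row_matrixP => i; rewrite !rowE mulmxA.
  by rewrite -[delta_mx 0 i]r2vK -!v2r_lfun bs mulmx1.
- apply/row_matrixP => i; rewrite !rowE mulmxDr !mulmxA.
  by rewrite -[delta_mx 0 i]r2vK -!v2r_lfun -linearD -E mulmx1.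
Qed.

Lemma split3_tensl U V W Z (a : 'Hom(U, V)) (b : 'Hom(V, W)) :
  split3 a b -> split3 (tensmap a (\1%VF : 'End(Z))) (tensmap b \1%VF).
Proof.
move=> [r [s /split3_f2mx [ba ra bs E]]].
exists (tensmap r \1%VF), (tensmap s \1%VF).
have f1 : f2mx (\1%VF : 'End(Z)) = 1%:M by apply: f2mx_id => z; rewrite id_lfunE.
split=> x; rewrite !tensmapE !f1 !mulmx1 ?mulmxA -?trmx_mul ?ba ?ra ?bs.
- by rewrite trmx0 mul0mx.
- by rewrite trmx1 mul1mx.
- by rewrite trmx1 mul1mx.
- by rewrite -mulmxDl -linearD /= E trmx1 mul1mx.
Qed.

Lemma split3_tensr U V W Z (a : 'Hom(U, V)) (b : 'Hom(V, W)) :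
  split3 a b -> split3 (tensmap (\1%VF : 'End(Z)) a) (tensmap \1%VF b).
Proof.
move=> [r [s /split3_f2mx [ba ra bs E]]].
exists (tensmap \1%VF r), (tensmap \1%VF s).
have f1 : f2mx (\1%VF : 'End(Z)) = 1%:M by apply: f2mx_id => z; rewrite id_lfunE.
split=> x; rewrite !tensmapE !f1 !trmx1 !mul1mx -?mulmxA ?ba ?ra ?bs.
- by rewrite mulmx0.
- by rewrite mulmx1.
- by rewrite mulmx1.
- by rewrite -mulmxDr E mulmx1.
Qed.

Lemma split3_dsum (I : finType) (U V W : I -> vectType k)
    (a : forall i, 'Hom(U i, V i)) (b : forall i, 'Hom(V i, W i)) :
  (forall i, exact3 (a i) (b i)) ->
  split3 (dsum_map (s := id) a) (dsum_map (s := id) b).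
Proof.
move=> abE; have ab i := exact3_splitting (abE i).
exists (dsum_map (s := id)
  (fun i => (a i)^-1 \o (\1%VF - ((b i)^-1 \o b i)%VF)%R)%VF).
exists (dsum_map (s := id) (fun i => ((b i)^-1)%VF)).
split=> x; apply/dsumP => i; have [ba ra bs E] := ab i.
- by rewrite !dsum_mapE ba (_ : (0 : dsum W) i = 0) // dsum_mkE.
- by rewrite !dsum_mapE ra.
- by rewrite !dsum_mapE bs.
- by rewrite (dsumDE (V := V)) !dsum_mapE -E.
Qed.
End Exactness.

Section DayExact.
Variable k : fieldType.

Lemma tensmap_sq (V V1 V2 V3 W W1 W2 W3 : vectType k)
    (f : 'Hom(V, V1)) (f' : 'Hom(V1, V3)) (g : 'Hom(V, V2)) (g' : 'Hom(V2, V3))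
    (p : 'Hom(W, W1)) (p' : 'Hom(W1, W3)) (q : 'Hom(W, W2))
    (q' : 'Hom(W2, W3)) x :
  (forall v, f' (f v) = g' (g v)) -> (forall w, p' (p w) = q' (q w)) ->
  tensmap f' p' (tensmap f p x) = tensmap g' q' (tensmap g q x).
Proof.
move=> fg pq.
rewrite -(@tensmap_comp _ _ _ _ _ _ _ f f' p p' (f' \o f)%VF (p' \o p)%VF).
- apply: tensmap_comp => v; rewrite comp_lfunE; [exact: fg | exact: pq].
- by move=> v; rewrite comp_lfunE.
- by move=> v; rewrite comp_lfunE.
Qed.

Section DayL.
Variables (M M' : module k FBFBop) (a : modmor M M') (N : module k FBop).
Definition dayl_map (x : FBFBop) : 'Hom(day M N x, day M' N x) :=
  dsum_map (s := id) (V := @day_comp k M N x) (W := @day_comp k M' N x)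
    (fun A => tensmap (a (x.1, subs A)) \1%VF).
Fact dayl_nat (x y : FBFBop) (f : arr x y) v :
  dayl_map y (mact (day M N) f v) = mact (day M' N) f (dayl_map x v).
Proof.
apply/dsumP => B; rewrite dsum_mapE.
rewrite !(day_actE _ (mem_bij_imset f.2 B) (mem_bij_imsetC f.2 B)) dsum_mapE.
by apply: tensmap_sq => w; rewrite ?id_lfunE // mmap_nat.
Qed.
Definition dayl : modmor (day M N) (day M' N) := Modmor dayl_nat.
End DayL.

Section DayR.
Variables (M : module k FBFBop) (N N' : module k FBop) (a : modmor N N').
Definition dayr_map (x : FBFBop) : 'Hom(day M N x, day M N' x) :=
  dsum_map (s := id) (V := @day_comp k M N x) (W := @day_comp k M N' x)
    (fun A => tensmap \1%VF (a (subs (~: A)))).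
Fact dayr_nat (x y : FBFBop) (f : arr x y) v :
  dayr_map y (mact (day M N) f v) = mact (day M N') f (dayr_map x v).
Proof.
apply/dsumP => B; rewrite dsum_mapE.
rewrite !(day_actE _ (mem_bij_imset f.2 B) (mem_bij_imsetC f.2 B)) dsum_mapE.
by apply: tensmap_sq => w; rewrite ?id_lfunE // mmap_nat.
Qed.
Definition dayr : modmor (day M N) (day M N') := Modmor dayr_nat.
End DayR.

Lemma short_exact_dayl (M' M M'' : module k FBFBop) (N : module k FBop) :
  short_exact M' M M'' -> short_exact (day M' N) (day M N) (day M'' N).
Proof.
move=> [a [b ab]]; exists (dayl a N), (dayl b N) => x.
apply: split3_exact; apply: split3_dsum => A; apply: split3_exact.
by apply: split3_tensl; apply: exact3_split; apply: ab.
Qed.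

Lemma short_exact_dayr (M : module k FBFBop) (N' N N'' : module k FBop) :
  short_exact N' N N'' -> short_exact (day M N') (day M N) (day M N'').
Proof.
move=> [a [b ab]]; exists (dayr M a), (dayr M b) => x.
apply: split3_exact; apply: split3_dsum => A; apply: split3_exact.
by apply: split3_tensr; apply: exact3_split; apply: ab.
Qed.

Lemma K0eq_add4 (C : category) (u v w z : K0 k C) :
  (u + v + (w + z) =K0 u + w + (v + z))%K0.
Proof.
apply: K0eq_trans (K0eq_sym (K0eq_addA _ _ _)) _.
apply: K0eq_trans _ (K0eq_addA _ _ _); apply: K0eq_add (K0eq_refl _) _.
apply: K0eq_trans (K0eq_addA _ _ _) _; apply: K0eq_trans _ (K0eq_sym (K0eq_addA _ _ _)).
by apply: K0eq_add (K0eq_addC _ _) (K0eq_refl _).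
Qed.

Lemma dayK0_compat (u u' : K0 k FBFBop) (v v' : K0 k FBop) :
  (u =K0 u' -> v =K0 v' -> u ⊙ v =K0 u' ⊙ v')%K0.
Proof.
move=> uu' vv'; apply: (@K0eq_trans _ _ _ (u' ⊙ v)%K0).
  elim: uu' => {u u'} /=.
  - by move=> u; apply: K0eq_refl.
  - by move=> *; apply: K0eq_sym.
  - by move=> u w z _ uw _; apply: K0eq_trans uw.
  - by move=> *; apply: K0eq_add.
  - by move=> *; apply: K0eq_opp.
  - by move=> *; apply: K0eq_addA.
  - by move=> *; apply: K0eq_addC.
  - by move=> *; apply: K0eq_add0.
  - by move=> *; apply: K0eq_addN.
  move=> M' M M'' Mse; elim: v {vv'} => [N||v IHv w IHw|v IHv] /=.
  - by apply/K0eq_ses/short_exact_dayl.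
  - by apply: K0eq_sym; apply: K0eq_add0.
  - by apply: K0eq_trans (K0eq_add IHv IHw) _; apply: K0eq_add4.
  - apply: K0eq_trans (K0eq_opp IHv) _.
    set p := dayK0_cls M' v; set q := dayK0_cls M'' v.
    have pqN : (- p + - q + (p + q) =K0 0)%K0.
      apply: K0eq_trans (K0eq_add4 _ _ _ _) _.
      apply: K0eq_trans (K0eq_add (K0eq_addN _) (K0eq_addN _)) _.
      exact: K0eq_add0.
    have pqNN : (p + q + - (p + q) =K0 0)%K0.
      by apply: K0eq_trans (K0eq_addC _ _) (K0eq_addN _).
    apply: K0eq_trans (K0eq_sym (K0eq_add0 _)) _.
    apply: K0eq_trans (K0eq_add (K0eq_sym pqN) (K0eq_refl _)) _.
    apply: K0eq_trans (K0eq_sym (K0eq_addA _ _ _)) _.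
    apply: K0eq_trans (K0eq_add (K0eq_refl _) pqNN) _.
    by apply: K0eq_trans (K0eq_addC _ _) (K0eq_add0 _).
elim: u' {uu'} => [M||u1 IH1 u2 IH2|u1 IH1] /=; last 3 first.
- exact: K0eq_refl.
- exact: K0eq_add.
- exact: K0eq_opp.
elim: vv' => {v v'} /=.
- by move=> *; apply: K0eq_refl.
- by move=> *; apply: K0eq_sym.
- by move=> x y z _ xy _; apply: K0eq_trans xy.
- by move=> *; apply: K0eq_add.
- by move=> *; apply: K0eq_opp.
- by move=> *; apply: K0eq_addA.
- by move=> *; apply: K0eq_addC.
- by move=> *; apply: K0eq_add0.
- by move=> *; apply: K0eq_addN.
by move=> *; apply/K0eq_ses/short_exact_dayr.
Qed.
End DayExact.

Section SumAt.
Variables (k : fieldType) (C : category) (I : eqType).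
Implicit Types (c : I -> K0 k C) (r : seq I).

Lemma K0eq_add0r (u v : K0 k C) : (u =K0 0 -> u + v =K0 v)%K0.
Proof.
by move=> u0; apply: K0eq_trans (K0eq_add u0 (K0eq_refl v)) (K0eq_add0 v).
Qed.

Lemma K0eq_addCA (u v w : K0 k C) : (u + (v + w) =K0 v + (u + w))%K0.
Proof.
apply: K0eq_trans (K0eq_addA _ _ _) _.
apply: K0eq_trans (K0eq_add (K0eq_addC _ _) (K0eq_refl _)) _.
exact: K0eq_sym (K0eq_addA _ _ _).
Qed.

Lemma K0sum_rem c r i :
  i \in r -> (K0sum r c =K0 c i + K0sum (rem i r) c)%K0.
Proof.
elim: r => //= j r IH; rewrite inE eq_sym; case: eqP => [-> _ | _ /= ir].
  exact: K0eq_refl.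
apply: K0eq_trans (K0eq_add (K0eq_refl _) (IH ir)) _; exact: K0eq_addCA.
Qed.

Lemma K0sum_eq0 c r :
  (forall i, i \in r -> (c i =K0 0)%K0) -> (K0sum r c =K0 0)%K0.
Proof.
elim: r => [|i r IH] r0 /=; first exact: K0eq_refl.
apply: K0eq_trans (K0eq_add0r _ (r0 i _)) (IH _); first by rewrite inE eqxx.
by move=> j jr; apply: r0; rewrite inE jr orbT.
Qed.

Lemma K0sum_support c r r' :
  uniq r -> uniq r' ->
  (forall i, (i \in r) != (i \in r') -> (c i =K0 0)%K0) ->
  (K0sum r c =K0 K0sum r' c)%K0.
Proof.
elim: r r' => [|i r IH] r' /=.
  by move=> _ _ r0; apply/K0eq_sym/K0sum_eq0 => i ir; apply: r0; rewrite ir.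
move=> /andP[ir Ur] Ur' c0; case: (boolP (i \in r')) => ir'.
  apply: K0eq_trans _ (K0eq_sym (K0sum_rem c ir')).
  apply: K0eq_add (K0eq_refl _) (IH _ Ur (rem_uniq _ Ur') _) => j.
  rewrite mem_rem_uniq // inE /=; case: (eqVneq j i) => [->|ji] /=.
    by rewrite (negPf ir).
  by move=> h; apply: c0; rewrite inE (negPf ji).
have ci : (c i =K0 0)%K0 by apply: c0; rewrite inE eqxx (negPf ir').
apply: K0eq_trans (K0eq_add0r _ ci) (IH _ Ur Ur' _) => j h.
apply: c0; rewrite inE; case: (eqVneq j i) h => [->|//].
by rewrite (negPf ir) (negPf ir').
Qed.
End SumAt.

Lemma is_sum_at_unique (k : fieldType) (C : category) (x : C) (I : eqType)
    (c : I -> K0 k C) (s s' : K0 k (full1 x)) :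
  is_sum_at c s -> is_sum_at c s' -> (s =K0 s')%K0.
Proof.
move=> [r [Ur r0 sE]] [r' [Ur' r'0 s'E]].
apply: K0eq_trans sE (K0eq_trans _ (K0eq_sym s'E)).
apply: K0sum_support => // i.
by have [_|/r0] := boolP (i \in r); have [//|/r'0] := boolP (i \in r').
Qed.

(* Main.v *)
(** Put m = |X| and n = |U|. A surjection from a subset of U onto X is a partial map
    g from U to X with image X; call the points where g is undefined stars. Once the
    set of stars is oriented, the right-hand side is the Euler characteristic of a
    Koszul type complex graded by the number of stars, whose differential turns one
    value into a star and whose cycles in degree 0 form kFS^0(U, X). In positive
    degrees it is exact, except in degree n - m > 0, where g is a bijection off the
    stars: there the homology is sgn (x) sgn, detected by turning the values into
    stars one point of X after the other.

    Exactness is by induction on X. If one point x0 of X is allowed not to be a value,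
    the complex becomes a quotient of a tensor product over U of complexes k X -> k,
    and inserting x0 at a star contracts it in positive degrees. The connecting map
    therefore identifies the homology for X in degree t > 0 with the homology for
    X \ x0 in degree t + 1. *)
Require Import Defs.
From HB Require Import structures.
From mathcomp Require Import all_boot all_order all_algebra.
From mathcomp Require Import fingroup perm zify.
From Corelib Require Import Setoid Morphisms.

Set Implicit Arguments.
Unset Strict Implicit.
Unset Printing Implicit Defensive.

Import GRing.Theory VectorInternalTheory.
Local Open Scope ring_scope.

(** * Orientation signs *)

(** Classes are compared through short exact sequences of representations of the bijections of X and
    of U, so every identification has to be equivariant. Orientation signs are read off
    enumerations, which bijections do not respect; [osign] (removing a star) and [rsign]
    (restricting a bijection to a set of stars) absorb the discrepancy, and [rsign_osign] makes the
    differential equivariant. The coefficient of a differential at [g] reads a chain at the maps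
    that fill a star of [g]; filling with a value already taken keeps the image. Restricting
    coefficient functions to the maps with a given image is therefore the passage to a quotient
    complex, and no separate complexes are built for the induction on X. That induction singles out
    the points of X one by one, so it is not equivariant. The symmetry reappears in the augmentation
    alone: reordering X produces the sign of X because the operators [delta x] anticommute, and the
    sign of U is the orientation character of the full set of stars. Characteristic zero serves to
    divide by 2. *)

Lemma odd_perm_extend (S R : finType) (h : S -> R) (p : {perm S})
    (q : {perm R}) :
  injective h -> (forall s, q (h s) = h (p s)) ->
  (forall r, r \notin codom h -> q r = r) -> q = p :> bool.
Proof.
move=> hI; have [ts -> _] := prod_tpermP p.
elim: ts q => [|t ts IH] q qh qN.
  suff -> : q = 1%g by rewrite big_nil !odd_perm1.
  apply/permP => r; rewrite perm1; have [/codomP[s ->]|/qN //] := boolP (r \in codom h).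
  by rewrite qh big_nil perm1.
rewrite big_cons odd_permM odd_tperm.
have <- := IH (tperm (h t.1) (h t.2) * q)%g.
- by rewrite odd_permM odd_tperm (inj_eq hI) addKb.
- by move=> s; rewrite permM -inj_tperm // qh big_cons permM tpermK.
move=> r rh; rewrite permM tpermD ?qN //; apply: contraNneq rh => <-; exact: codom_f.
Qed.

Section OptionBij.
Implicit Types S T R : finType.

Fact bopt_subproof S T (f : bij S T) 
    (g := [ffun o => omap (sval f) o] : {ffun option S -> option T}) :
  injectiveb g && surjectiveb g.
Proof.
apply/andP; split.
  apply/injectiveP => -[a|] [b|] //; rewrite !ffunE //= => -[fab].
  by rewrite (Defs.bij_inj fab).
apply/surjectiveP => -[t|]; last by exists None; rewrite ffunE.
have /surjectiveP/(_ t)[s <-] := bij_surjb f.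
by exists (Some s); rewrite ffunE.
Qed.
Definition bopt S T (f : bij S T) : bij (option S) (option T) :=
  Bij (bopt_subproof f).

Lemma enum_rank_Some S (s : S) : enum_rank (Some s) = (enum_rank s).+1 :> nat.
Proof.
have iE (T : finType) (t : T) : enum_rank t = index t (enum T) :> nat.
  by rewrite -[in RHS](enum_rankK t) (enum_val_nth t) index_uniq ?enum_uniq -?cardE.
by rewrite !iE enumT [in LHS]unlock /= index_map ?enumT //; apply: Some_inj.
Qed.

Lemma enum_bij_Some S T (e : #|S| = #|T|)
    (e' : #|{: option S}| = #|{: option T}|) (s : S) :
  enum_bij e' (Some s) = Some (enum_bij e s).
Proof.
apply: enum_rank_inj; apply: val_inj.
by rewrite /enum_bij enum_valK /= !enum_rank_Some enum_valK.
Qed.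

(** The enumeration of an option type lists [None] first, on both sides, so the permutation attached
    to [bopt f] extends that of [f] by a fixed point. *)
Lemma bij_sign_opt (k : fieldType) S T (f : bij S T) :
  bij_sign k (bopt f) = bij_sign k f.
Proof.
have optE s : bij_perm (bopt f) (Some s) = Some (bij_perm f s).
  by rewrite !permE ffunE /=; exact: enum_bij_Some.
congr (_ ^+ nat_of_bool _); apply: (@odd_perm_extend _ _ Some) => //.
  exact: Some_inj.
case=> [s|_]; first by rewrite codom_f.
case E: (bij_perm _ _) => [t|//]; move: (E).
have <- : bij_perm (bopt f) (Some ((bij_perm f)^-1 t)%g) = Some t by rewrite optE permKV.
by move/perm_inj.
Qed.
End OptionBij.
Section StarSign.
Variables (k : fieldType) (U : finType).
Implicit Types (S R : {set U}) (u v w : U).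

Lemma insub_subs R u (uR : u \in R) :
  insub u = Some (exist (fun u => u \in R) u uR) :> option (subs R).
Proof. by rewrite insubT. Qed.

(** Used with [R = S :\ v], where it is a bijection: [v] becomes the point [None], which comes first
    in the enumeration of an option type. *)
Definition split1 S R : {ffun subs S -> option (subs R)} :=
  [ffun s => insub (sval s)].

Fact split1_bij S v : v \in S ->
  injectiveb (split1 S (S :\ v)) && surjectiveb (split1 S (S :\ v)).
Proof.
move=> vS; apply/andP; split.
  apply/injectiveP => -[a aS] [b bS]; rewrite !ffunE /= => ab.
  apply: val_inj => /=; move: ab.
  by case: insubP => [x xS xa|]; case: insubP => [y yS yb|] //;
    [case=> xy; rewrite -xa -yb xy | rewrite !inE aS bS !andbT !negbK => /eqP-> /eqP->].
apply/surjectiveP => -[[a aS]|].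
  have /setD1P[av aS'] := aS.
  by exists (exist (fun u => u \in S) a aS'); rewrite ffunE /= insubT.
by exists (exist (fun u => u \in S) v vS); rewrite ffunE /= insubN // !inE eqxx.
Qed.

(* The sign of the shuffle moving v to the front of S. *)
Definition osign S v : k :=
  if insub (split1 S (S :\ v)) is Some f then
    bij_sign k (f : bij (subs S) (option (subs (S :\ v)))) else 1.

Lemma osignE S v (vS : v \in S) : osign S v = bij_sign k (Bij (split1_bij vS)).
Proof.
rewrite /osign; case: insubP => [f _ fE|]; last by rewrite split1_bij.
by congr bij_sign; apply: val_inj.
Qed.

Lemma bij_sign_sqr (S T : finType) (f : bij S T) : bij_sign k f * bij_sign k f = 1.
Proof. by rewrite -expr2 sqrr_sign. Qed.

Lemma osign_sqr S v : osign S v * osign S v = 1.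
Proof. by rewrite /osign; case: insubP => [f _ _|_]; rewrite ?bij_sign_sqr ?mulr1. Qed.

Fact swap2_bij (T : finType)
  (f := [ffun o => tperm None (Some None) o] : {ffun option (option T) -> option (option T)}) :
  injectiveb f && surjectiveb f.
Proof.
apply/andP; split; first by apply/injectiveP => a b; rewrite !ffunE; apply: perm_inj.
by apply/surjectiveP => t; exists (tperm None (Some None) t); rewrite ffunE tpermK.
Qed.

Lemma swap2_sign (T : finType) : bij_sign k (Bij (swap2_bij T)) = -1.
Proof.
rewrite /bij_sign (_ : bij_perm _ = tperm None (Some None)) ?odd_tperm ?expr1 //.
by apply/permP => s; rewrite bij_perm_aut ffunE.
Qed.

(** Removing two points in either order identifies [S] with the twofold option type over the rest;
    the two identifications differ by the transposition of the added points. *)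
Lemma osign_anticomm S v w : v \in S -> w \in S -> v != w ->
  osign S v * osign (S :\ v) w = - (osign S w * osign (S :\ w) v).
Proof.
move=> vS wS vw.
have wS' : w \in S :\ v by rewrite !inE eq_sym vw.
have vS' : v \in S :\ w by rewrite !inE vw.
rewrite (osignE vS) (osignE wS) (osignE wS') (osignE vS').
rewrite -[X in _ * X = _]bij_sign_opt -[X in - (_ * X)]bij_sign_opt.
rewrite ![_ * bij_sign _ (bopt _)]mulrC -!bij_signM.
have SE : S :\ w :\ v = S :\ v :\ w by apply/setP => u; rewrite !inE andbCA.
move: (split1_bij vS'); rewrite SE => vS''.
rewrite -mulN1r -(swap2_sign (subs (S :\ v :\ w))) -bij_signM.
congr bij_sign; apply: val_inj; apply/ffunP => -[u uS] /=; rewrite !ffunE /=.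
have [->|uv] := eqVneq u v.
  rewrite insubN ?inE ?eqxx //= (insub_subs vS') /= ffunE /= insubN ?tpermR //.
  by rewrite !inE eqxx andbF.
have [->|uw] := eqVneq u w.
  rewrite (insub_subs wS') /= ffunE /= insubN ?inE ?eqxx //.
  by rewrite insubN ?inE ?eqxx //= tpermL.
have h1 : u \in S :\ v by rewrite !inE uv.
have h2 : u \in S :\ w by rewrite !inE uw.
have h3 : u \in S :\ v :\ w by rewrite !inE uv uw.
by rewrite (insub_subs h1) (insub_subs h2) /= !ffunE /= (insub_subs h3) tpermD.
Qed.

Variable t : bij U U.

Definition rsign S : k := bij_sign k (restr (mem_bij_imset t S)).

Lemma rsignE S R (h : forall v, (v \in S) = (sval t v \in R)) :
  bij_sign k (restr h) = rsign S.
Proof.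
have eR : sval t @: S = R.
  apply/setP => u; have /surjectiveP/(_ u) [z <-] := bij_surjb t.
  by rewrite -mem_bij_imset h.
by case: _ / eR in h *; rewrite (restr_irr h (mem_bij_imset t S)).
Qed.

(** Restricting [t] commutes with splitting off [v] in the source and [t v] in the target; the sign
    is multiplicative and each sign is its own inverse. *)
Lemma rsign_osign S v : v \in S ->
  rsign S = osign S v * osign (sval t @: S) (sval t v) * rsign (S :\ v).
Proof.
move=> vS; have tvS : sval t v \in sval t @: S by rewrite -mem_bij_imset.
have h u : (u \in S :\ v) = (sval t u \in sval t @: S :\ sval t v).
  by rewrite !inE -mem_bij_imset (inj_eq (@Defs.bij_inj _ _ t)).
rewrite -(rsignE h) (osignE vS) (osignE tvS) -[X in _ = _ * X]bij_sign_opt.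
rewrite -mulrA mulrCA [X in _ = _ * X]mulrC -[LHS]mul1r.
rewrite -(bij_sign_sqr (Bij (split1_bij tvS))) -[LHS]mulrA; congr (_ * _).
rewrite -!bij_signM; congr bij_sign; apply: val_inj.
apply/ffunP => -[u uS] /=; rewrite !ffunE /=.
have [->|uv] := eqVneq u v; first by rewrite !insubN ?inE ?eqxx.
have h1 : u \in S :\ v by rewrite !inE uv.
have h2 : sval t u \in sval t @: S :\ sval t v by rewrite -h.
by rewrite (insub_subs h1) (insub_subs h2) /= ffunE; congr Some; apply: val_inj.
Qed.

Fact in_setT_bij
  (f := [ffun u => exist (fun u => u \in [set: U]) u (in_setT u)] : {ffun U -> subs [set: U]}) :
  injectiveb f && surjectiveb f.
Proof.
apply/andP; split; first by apply/injectiveP => u v; rewrite !ffunE => -[].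
by apply/surjectiveP => -[u uT]; exists u; rewrite ffunE; apply: val_inj.
Qed.

(** When every point is a star, the orientation transforms by the sign of [t]: the origin of the
    sign representation in the variable U. *)
Lemma rsign_setT : rsign [set: U] = bij_sign k t.
Proof.
have h u : (u \in [set: U]) = (sval t u \in [set: U]) by rewrite !inE.
rewrite -(rsignE h) -[RHS]mul1r -(bij_sign_sqr (Bij in_setT_bij)) -[RHS]mulrA.
rewrite -bij_signM -[LHS]mul1r -(bij_sign_sqr (Bij in_setT_bij)) -[LHS]mulrA.
congr (_ * _); rewrite [LHS]mulrC -bij_signM; congr bij_sign; apply: val_inj.
by apply/ffunP => u; apply: val_inj; rewrite /= !ffunE /=.
Qed.
End StarSign.

(** * Exactness of the Koszul complex *)

Section Koszul.
Variables (k : fieldType) (X U : finType).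
Local Notation pfun := {ffun U -> option X}.
Implicit Types (g : pfun) (u v w : U) (x z : X) (Y : {set X}) (y a b : pfun -> k).

Definition upd g v (o : option X) : pfun := [ffun w => if w == v then o else g w].
Definition stars g : {set U} := [set v | g v == None].
Definition pim g : {set X} := [set x | [exists v, g v == Some x]].

Lemma upd_eq g v o : upd g v o v = o. Proof. by rewrite ffunE eqxx. Qed.
Lemma upd_neq g v o w : w != v -> upd g v o w = g w.
Proof. by rewrite ffunE => /negPf->. Qed.
Lemma upd_upd g v o o' : upd (upd g v o) v o' = upd g v o'.
Proof. by apply/ffunP => w; rewrite !ffunE; case: eqP. Qed.
Lemma upd_id g v : upd g v (g v) = g.
Proof. by apply/ffunP => w; rewrite !ffunE; case: eqP => [->|]. Qed.
Lemma updC g v w o o' : v != w -> upd (upd g v o) w o' = upd (upd g w o') v o.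
Proof.
move=> vw; apply/ffunP => t; rewrite !ffunE.
by have [->|//] := eqVneq t w; rewrite eq_sym (negPf vw).
Qed.

Lemma mem_stars g v : (v \in stars g) = (g v == None). Proof. by rewrite inE. Qed.
Lemma stars_upd g v x : stars (upd g v (Some x)) = stars g :\ v.
Proof. by apply/setP => w; rewrite !inE ffunE; case: (w == v). Qed.
Lemma stars_updN g v : stars (upd g v None) = v |: stars g.
Proof. by apply/setP => w; rewrite !inE ffunE; case: (w == v). Qed.

Lemma mem_pim g v x : g v = Some x -> x \in pim g.
Proof. by move=> gv; rewrite inE; apply/existsP; exists v; rewrite gv. Qed.
Lemma pimP g x : reflect (exists v, g v = Some x) (x \in pim g).
Proof. by rewrite inE; apply: (iffP existsP) => -[v h]; exists v; exact/eqP. Qed.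

Lemma pim_upd g v x : v \in stars g -> pim (upd g v (Some x)) = x |: pim g.
Proof.
rewrite mem_stars => /eqP gv; apply/setP => z; rewrite in_setU1.
apply/pimP/orP => [[w]|[/eqP->|/pimP[w gw]]].
- rewrite ffunE; case: eqP => [_ [->]|_ gw]; first by rewrite eqxx; left.
  by right; apply: mem_pim gw.
- by exists v; rewrite upd_eq.
- by exists w; rewrite upd_neq //; apply/eqP => wv; rewrite wv gv in gw.
Qed.

(* y is the coefficient function of a chain; the value at g collects the ways of
   turning one occurrence of the value x into a star (a point sent to None). *)
Definition delta x y g : k :=
  \sum_(v in stars g) osign k (stars g) v * y (upd g v (Some x)).

Lemma eq_delta x y a g :
  (forall v, v \in stars g -> y (upd g v (Some x)) = a (upd g v (Some x))) ->
  delta x y g = delta x a g.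
Proof. by move=> ya; apply: eq_bigr => v vS; rewrite ya. Qed.

Lemma delta0 x g : delta x (fun=> 0) g = 0.
Proof. by apply: big1 => v _; rewrite mulr0. Qed.

Lemma delta_sum (I : Type) (r : seq I) (P : pred I) x (F : I -> pfun -> k) g :
  delta x (fun g => \sum_(i <- r | P i) F i g) g = \sum_(i <- r | P i) delta x (F i) g.
Proof.
by rewrite /delta exchange_big; apply: eq_bigr => v _; rewrite mulr_sumr.
Qed.

(** Two such operators fill an ordered pair of distinct stars. Exchanging the members of the pair
    exchanges the two values and, by [osign_anticomm], changes the sign. *)
Lemma delta_anticomm x z y g : delta x (delta z y) g = - delta z (delta x y) g.
Proof.
have dE (a b : X) : delta a (delta b y) g =
    \sum_(p : U * U | [&& p.1 \in stars g, p.2 \in stars g & p.1 != p.2])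
      osign k (stars g) p.1 * osign k (stars g :\ p.1) p.2 *
      y (upd (upd g p.1 (Some a)) p.2 (Some b)).
  rewrite /delta; under eq_bigr => v _ do rewrite mulr_sumr.
  rewrite pair_big_dep /=; apply: eq_big => [[v w]|[v w] _] /=; rewrite stars_upd ?mulrA //.
  by rewrite !inE [w == v]eq_sym; do !case: (_ == _).
rewrite !dE -sumrN [RHS](reindex_inj (h := fun p : U * U => (p.2, p.1))) /=; last first.
  by move=> [? ?] [? ?] [-> ->].
apply: eq_big => [[v w]|[v w] /= /and3P[vS wS vw]] /=.
  by rewrite [w == v]eq_sym; case: (v \in _); case: (w \in _).
by rewrite (osign_anticomm k vS wS vw) mulNr (updC _ _ _ vw).
Qed.

(** Values range over [Y] rather than X: at [g] with [pim g = Y] this is the differential of the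
    complex of maps with image [Y], which lets the induction on X stay inside one type of partial
    maps. *)
Definition kdiff Y y g : k := \sum_(x in Y) delta x y g.

Lemma eq_kdiff Y y a g :
  (forall v x, v \in stars g -> x \in Y -> y (upd g v (Some x)) = a (upd g v (Some x))) ->
  kdiff Y y g = kdiff Y a g.
Proof. by move=> ya; apply: eq_bigr => x xY; apply: eq_delta => v vS; apply: ya. Qed.

Lemma kdiff_total Y y g : stars g = set0 -> kdiff Y y g = 0.
Proof. by move=> g0; apply: big1 => x _; rewrite /delta g0 big_set0. Qed.

Lemma kdiff_lin Y (c : k) y a g :
  kdiff Y (fun g => c * y g + a g) g = c * kdiff Y y g + kdiff Y a g.
Proof.
rewrite /kdiff mulr_sumr -big_split; apply: eq_bigr => x _ /=.
by rewrite /delta mulr_sumr -big_split; apply: eq_bigr => v _; rewrite mulrDr mulrCA.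
Qed.

Lemma kdiffB Y y a g : kdiff Y (fun g => y g - a g) g = kdiff Y y g - kdiff Y a g.
Proof.
rewrite addrC -mulN1r -kdiff_lin; apply: eq_kdiff => v x _ _.
by rewrite mulN1r addrC.
Qed.

Lemma kdiffD Y y a g : kdiff Y (fun g => y g + a g) g = kdiff Y y g + kdiff Y a g.
Proof.
by rewrite -[X in X + _]mul1r -kdiff_lin; apply: eq_kdiff => v x _ _; rewrite mul1r.
Qed.

Hypothesis char0 : [pchar k] =i pred0.

Lemma kdiff_sqr Y y g : kdiff Y (kdiff Y y) g = 0.
Proof.
have dE : kdiff Y (kdiff Y y) g =
    \sum_(x in Y) \sum_(z in Y) delta x (delta z y) g.
  by apply: eq_bigr => x _; rewrite delta_sum.
have dN : kdiff Y (kdiff Y y) g = - kdiff Y (kdiff Y y) g.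
  rewrite {1}dE exchange_big dE -sumrN; apply: eq_bigr => x _.
  by rewrite -sumrN; apply: eq_bigr => z _; apply: delta_anticomm.
move/eqP: dN; rewrite -addr_eq0 -mulr2n -mulr_natr mulf_eq0.
by rewrite (pcharf0P k).1 // orbF => /eqP.
Qed.

Section Homotopy.
Variables (Y : {set X}) (x0 : X).
Hypothesis x0Y : x0 \in Y.

(* Contracts the factor at u of the tensor product over U of the complexes
   k X -> k: it sends None to x0. *)
Definition homot u y g : k :=
  if g u == Some x0 then osign k (u |: stars g) u * y (upd g u None) else 0.

(** This is [id - dh - hd] for h the contraction [homot u]. On the factor at [u] it kills [None] and
    sends a value [x] of [Y] to [x - x0], so it projects onto the kernel of k Y -> k. *)
Definition hproj u y g : k :=
  (if g u == None then 0 else y g) -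
  (if g u == Some x0 then \sum_(x in Y) y (upd g u (Some x)) else 0).

Lemma homot_kdiff u y g :
  y g = hproj u y g + kdiff Y (homot u y) g + homot u (kdiff Y y) g.
Proof.
rewrite /hproj {2}/homot; case gu: (g u) => [z|] /=; last first.
  rewrite subrr add0r addr0 /kdiff (bigD1 x0) //= big1 ?addr0 => [|x /andP[_ xx0]].
    rewrite /delta (bigD1 u) ?mem_stars ?gu //= big1 ?addr0 => [|v /andP[_ vu]].
      rewrite /homot upd_eq eqxx stars_upd upd_upd -gu upd_id setD1K ?mem_stars ?gu //.
      by rewrite mulrA osign_sqr mul1r.
    by rewrite /homot upd_neq 1?eq_sym // gu mulr0.
  apply: big1 => v _; rewrite /homot ffunE.
  by case: (u == v); rewrite ?gu ?(inj_eq Some_inj) ?(negPf xx0) mulr0.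
rewrite (inj_eq Some_inj); case: eqP => [zx|zx]; last first.
  rewrite subr0 addr0 /kdiff big1 ?addr0 // => x _; apply: big1 => v.
  rewrite mem_stars => /eqP gv; rewrite /homot upd_neq.
    by rewrite gu (inj_eq Some_inj) (introF eqP zx) mulr0.
  by apply/eqP => uv; rewrite uv gv in gu.
(* At a map with value [x0] at [u], [hd] fills a star after [u] has been freed. Filling [u] itself
   gives the sum subtracted in [hproj]; filling any other star cancels against [dh] by
   [osign_anticomm]. *)
rewrite {}zx in gu; suff dE : forall x, y (upd g u (Some x)) =
    delta x (homot u y) g + osign k (u |: stars g) u * delta x y (upd g u None).
  rewrite /kdiff mulr_sumr -addrA -big_split /= -(eq_bigr _ (fun x _ => dE x)).
  by rewrite subrK.
move=> x; rewrite {2}/delta stars_updN big_setU1 ?mem_stars ?gu //= upd_upd.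
rewrite mulrDr mulrA osign_sqr mul1r addrCA -[LHS]addr0; congr (_ + _).
rewrite mulr_sumr -big_split big1 //= => v vS.
have uv : u != v by apply: contraTneq vS => <-; rewrite mem_stars gu.
rewrite /homot upd_neq // gu eqxx stars_upd (updC _ _ _ uv) !mulrA -mulrDl.
have uS : u \notin stars g by rewrite mem_stars gu.
have -> : u |: stars g :\ v = (u |: stars g) :\ v.
  by apply/setP => w; rewrite !inE; have [->|] := eqVneq w u; rewrite ?uv.
have uT : u \in u |: stars g by rewrite setU11.
have vT : v \in u |: stars g by rewrite setU1r.
have := osign_anticomm k uT vT uv; rewrite setU1K // => h.
rewrite -[X in X + _]mul1r -(osign_sqr k (u |: stars g) v) -!mulrA.
rewrite [osign _ (stars g) v * _]mulrC.
rewrite [X in _ * X + _]mulrA -[X in _ * (X * _)]opprK -h.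
rewrite mulNr mulrN -!mulrA osign_sqr mulr1.
by rewrite [X in - X]mulrC addNr mul0r.
Qed.

(** [Q] selects the maps on which chains are considered: closure under filling makes this a quotient
    complex, and closure under freeing a point of value [x0] makes the homotopies act on it.
    Applying [hproj] at the points of U one after the other gives a homologous cycle vanishing
    wherever a treated point is a star; at the end only total maps remain, and there it is zero
    since [hproj] does not change the number of stars. *)
Lemma kdiff_exact_opt (Q : pred pfun) y :
  (forall g v x, Q g -> v \in stars g -> x \in Y -> Q (upd g v (Some x))) ->
  (forall g u, Q g -> g u = Some x0 -> Q (upd g u None)) ->
  (forall g, Q g -> kdiff Y y g = 0) ->
  (forall g, Q g -> stars g = set0 -> y g = 0) ->
  exists a, forall g, Q g -> y g = kdiff Y a g.
Proof.
move=> Qupd QupdN dy0 y0.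
have eqQ b c : (forall g, Q g -> b g = c g) ->
    forall g, Q g -> kdiff Y b g = kdiff Y c g.
  by move=> bc g Qg; apply: eq_kdiff => v x vS xY; apply/bc/Qupd.
have [b [a [yE db0 b0 bS]]] : exists b a, [/\ forall g, Q g -> y g = b g + kdiff Y a g,
    forall g, Q g -> kdiff Y b g = 0, forall g, Q g -> stars g = set0 -> b g = 0
    & forall g u, Q g -> u \in enum U -> g u = None -> b g = 0].
  elim: (enum U) => [|u us [b [a [yE db0 b0 bS]]]].
    exists y, (fun=> 0); split=> // g Qg.
    by rewrite /kdiff big1 ?addr0 // => x _; apply: delta0.
  have bE g : Q g -> b g = hproj u b g + kdiff Y (homot u b) g.
    move=> Qg; rewrite {1}(homot_kdiff u b g) /homot -/(homot u b).
    case: eqP => [gu|_]; last by rewrite addr0.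
    by rewrite [X in _ + _ * X]db0 ?mulr0 ?addr0 //; apply: QupdN.
  have updS g x : g u = Some x0 -> stars (upd g u (Some x)) = stars g.
    by move=> gu; apply/setP => w; rewrite !inE ffunE; have [->|//] := eqVneq w u; rewrite gu.
  have Qu g x : Q g -> g u = Some x0 -> x \in Y -> Q (upd g u (Some x)).
    move=> Qg gu xY; rewrite -(upd_upd g u None); apply: Qupd => //; first exact: QupdN.
    by rewrite mem_stars upd_eq.
  exists (hproj u b), (fun g => a g + homot u b g); split.
  - by move=> g Qg; rewrite (kdiffD Y a (homot u b)) addrCA -bE // addrC yE.
  - move=> g Qg; rewrite (eqQ _ (fun g => b g - kdiff Y (homot u b) g)) //.
      by rewrite (kdiffB Y b) db0 // kdiff_sqr subrr.
    by move=> h Qh; rewrite (bE h) // addrK.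
  - move=> g Qg g0; rewrite /hproj b0 // if_same sub0r.
    by case: eqP => [gu|]; rewrite ?big1 ?oppr0 // => x xY; rewrite b0 ?Qu ?updS.
  move=> g w Qg; rewrite inE /hproj => /predU1P[-> gu|wus gw].
    by rewrite gu eqxx subr0.
  rewrite (bS g w) // if_same sub0r; case: eqP => [gu|]; rewrite ?oppr0 //.
  rewrite big1 ?oppr0 // => x xY; rewrite (bS _ w) ?Qu // upd_neq //.
  by apply/eqP => wu; rewrite -wu gw in gu.
exists a => g Qg; rewrite yE // [b g](_ : _ = 0) ?add0r //.
have [g0|[u]] := set_0Vmem (stars g); first exact: b0.
by rewrite mem_stars => /eqP gu; rewrite (bS g u) ?mem_enum.
Qed.
End Homotopy.

(* With l = enum X, evaluated at the map without values, this is the map from the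
   chains with n - m stars to the sign representation. *)
Definition aug (l : seq X) y : pfun -> k := foldl (fun y x => delta x y) y l.

Lemma eq_aug (l : seq X) y a g :
  (forall h, pim h = pim g :|: [set x in l] -> y h = a h) -> aug l y g = aug l a g.
Proof.
elim: l y a => [|x l IH] y a ya /=; first by apply: ya; rewrite set_nil setU0.
apply: IH => h hE; apply: eq_delta => v vS; apply: ya.
by rewrite pim_upd // hE set_cons setUCA.
Qed.

(* Lift y to the complex where the value x0 is optional, correct the lift by a
   chain b' not using x0 so that it becomes a cycle, and contract. *)
Lemma kdiff_exact (l : seq X) y : uniq l ->
  (forall g, pim g = [set x in l] -> kdiff [set x in l] y g = 0) ->
  (forall g, pim g = [set x in l] -> stars g = set0 -> y g = 0) ->
  aug l y [ffun=> None] = 0 ->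
  exists b, forall g, pim g = [set x in l] -> y g = kdiff [set x in l] b g.
Proof.
elim: l y => [|x0 l IH] y /=.
  (* Without values the empty partial map is the only one, and there the augmentation is the
     coefficient itself. *)
  move=> _ _ _ y0; exists (fun=> 0) => g g0; rewrite /kdiff set_nil big_set0.
  rewrite (_ : g = [ffun=> None]) //; apply/ffunP => u; rewrite ffunE.
  case gu: (g u) => [x|//]; have := mem_pim gu.
  by rewrite g0 inE.
move=> /andP[x0l Ul] dy0 y0 augy; set Y := [set x in x0 :: l] in dy0 y0 *.
set Z := [set x in l] in IH; have YE : Y = x0 |: Z by rewrite /Y set_cons.
have x0Z : x0 \notin Z by rewrite inE.
have x0Y : x0 \in Y by rewrite YE setU11.
have neZY : Z <> Y by move=> ZY; rewrite ZY x0Y in x0Z.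
(* The lift of [y] that is zero on maps avoiding [x0]. *)
pose y' g := if pim g == Y then y g else 0.
have y'Y g : pim g = Y -> y' g = y g by rewrite /y' => ->; rewrite eqxx.
have pimY g v x : v \in stars g -> x \in Y -> pim g = Y -> pim (upd g v (Some x)) = Y.
  by move=> vS xY gY; rewrite pim_upd // gY; apply/setUidPr; rewrite sub1set.
have dy'Y g : pim g = Y -> kdiff Y y' g = 0.
  by move=> gY; rewrite -[RHS](dy0 g) //; apply: eq_kdiff => v x vS xY; rewrite y'Y ?pimY.
have kdY b g : kdiff Y b g = delta x0 b g + kdiff Z b g by rewrite /kdiff YE big_setU1.
have pimZ g v x : v \in stars g -> x \in Z -> pim g = Z -> pim (upd g v (Some x)) = Z.
  by move=> vS xZ gZ; rewrite pim_upd // gZ; apply/setUidPr; rewrite sub1set.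
have y'Z g : pim g = Z -> kdiff Z y' g = 0.
  move=> gZ; apply: big1 => x xZ; rewrite -(delta0 x g); apply: eq_delta => v vS.
  by rewrite /y' pimZ //; case: eqP.
have dx0 b g : (forall h, pim h = Y -> b h = 0) -> pim g = Z -> delta x0 b g = 0.
  move=> b0 gZ; rewrite -(delta0 x0 g); apply: eq_delta => v vS.
  by rewrite b0 // pim_upd // gZ.
(* On maps with image [Z] this is the image of [y] under the connecting map. Only fillings by [x0]
   count there, so its augmentation along [l] is that of [y] along [x0 :: l]. *)
have [|||b bE] := IH (kdiff Y y') Ul.
- move=> g gZ; have := kdiff_sqr Y y' g; rewrite kdY dx0 ?add0r //.
- by move=> g _ /kdiff_total ->.
- rewrite -augy; apply: eq_aug => g; rewrite (_ : pim [ffun=> None] = set0) ?set0U => [gZ|].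
    rewrite kdY y'Z // addr0; apply: eq_delta => v vS.
    by rewrite y'Y // pim_upd // gZ YE.
  by apply/setP => x; rewrite in_set0; apply/negP => /pimP[u]; rewrite ffunE.
(* Coefficients of [b] at total maps are dropped, as the contraction works in positive degrees only.
   The equation survives at maps with one star because [y] vanishes on total maps, so both sides are
   zero there. *)
pose b' g := if (pim g == Z) && (stars g != set0) then b g else 0.
have b'Y g : pim g = Y -> b' g = 0 by rewrite /b' => ->; case: eqP => // ZY; case: neZY.
have b'E g : pim g = Z -> kdiff Z b' g = kdiff Y y' g.
  move=> gZ; rewrite bE //.
  have [g1|g1] := boolP (1 < #|stars g|)%N.
    apply: eq_kdiff => v x vS xZ; rewrite /b' pimZ // eqxx stars_upd.
    by rewrite -card_gt0 (cardsD1 v) vS in g1 *; rewrite ltnS in g1; rewrite g1.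
  transitivity (0 : k).
    rewrite /kdiff big1 // => x xZ; rewrite -(delta0 x g); apply: eq_delta => v vS.
    rewrite /b' stars_upd; case: eqP => //= _; case: eqP => //= /eqP.
    by rewrite -card_gt0 (cardsD1 v (stars g)) vS ltnS in g1 *; rewrite (negPf g1).
  rewrite -bE // kdY y'Z // addr0 -(delta0 x0 g); apply/esym/eq_delta => v vS.
  rewrite y'Y ?pim_upd ?gZ ?YE // y0 ?pim_upd ?gZ ?YE // stars_upd.
  apply/eqP; rewrite -cards_eq0 -leqn0 -ltnS; move: g1.
  by rewrite (cardsD1 v (stars g)) vS -leqNgt.
(* The predicate selects the maps with image [Z] or [Y]: the complex in which [x0] is optional. *)
have [||||a aE] := @kdiff_exact_opt Y x0 x0Y
    (fun g => (Z \subset pim g) && (pim g \subset Y)) (fun g => y' g - b' g).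
- move=> g v x /andP[Zg gY] vS xY; rewrite pim_upd //.
  by rewrite (subset_trans Zg) ?subsetUr //= subUset sub1set xY.
- move=> g u /andP[/subsetP Zg /subsetP gY] gu; apply/andP; split; apply/subsetP => x.
    move=> xZ; have /pimP[w gw] := Zg x xZ; apply: (@mem_pim _ w); rewrite upd_neq //.
    by apply/eqP => wu; move: xZ x0Z; rewrite wu gu in gw; case: gw => ->; move=> ->.
  case/pimP => w; rewrite ffunE; case: eqP => // _ gw; exact/gY/(mem_pim gw).
- move=> g /andP[Zg gY]; rewrite kdiffB.
  have [gZ|gZ] := eqVneq (pim g) Z.
    by rewrite (kdY b') dx0 // add0r b'E // subrr.
  have {}gY : pim g = Y.
    apply/eqP; rewrite eqEsubset gY YE subUset Zg andbT sub1set.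
    apply: contraNT gZ => x0g; rewrite eqEsubset Zg andbT; apply/subsetP => x xg.
    have := subsetP gY _ xg; rewrite YE in_setU1 => /predU1P[xx0|//].
    by rewrite -xx0 xg in x0g.
  rewrite dy'Y // sub0r /kdiff big1 ?oppr0 // => x xY; rewrite -(delta0 x g).
  by apply: eq_delta => v vS; rewrite b'Y // pimY.
- by move=> g _ g0; rewrite /y' /b' g0 eqxx andbF subr0; case: eqP => // gY; rewrite y0.
exists a => g gY; rewrite -y'Y // -[LHS]subr0 -(b'Y g) // aE //.
by rewrite gY YE subsetUr subxx.
Qed.
End Koszul.

(** * Equivariance *)

Section BijInverse.
Variables (S T : finType) (f : bij S T).

Definition binv_fun : {ffun T -> S} := [ffun t => iinv (forallP (bij_surjb f) t)].

Lemma binv_funK : cancel binv_fun (sval f).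
Proof. by move=> t; rewrite ffunE f_iinv. Qed.

Lemma bij_funK : cancel (sval f) binv_fun.
Proof. by move=> s; apply: (@Defs.bij_inj _ _ f); rewrite binv_funK. Qed.

Fact binv_bij : injectiveb binv_fun && surjectiveb binv_fun.
Proof.
apply/andP; split; first exact/injectiveP/(can_inj binv_funK).
by apply/surjectiveP => s; exists (sval f s); rewrite bij_funK.
Qed.
Definition binv : bij T S := Bij binv_bij.
Lemma bijK : cancel (sval f) (sval binv). Proof. exact: bij_funK. Qed.
Lemma binvK : cancel (sval binv) (sval f). Proof. exact: binv_funK. Qed.
End BijInverse.

(** * Dependence of the augmentation on the order of X *)

Section Augmentation.
Variables (k : fieldType) (X U : finType).
Local Notation pfun := {ffun U -> option X}.
Implicit Types (g : pfun) (x z : X) (y a : pfun -> k) (l : seq X).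

Lemma aug_ext l y a g : (forall h, y h = a h) -> aug l y g = aug l a g.
Proof. by move=> ya; apply: eq_aug => h _. Qed.

Lemma augZ l (c : k) y g : aug l (fun h => c * y h) g = c * aug l y g.
Proof.
elim: l y => //= x l IH y; rewrite -IH; apply: aug_ext => h.
by rewrite /delta mulr_sumr; apply: eq_bigr => v _; rewrite mulrCA.
Qed.

Lemma augD l y a g : aug l (fun h => y h + a h) g = aug l y g + aug l a g.
Proof.
elim: l y a => //= x l IH y a; rewrite -IH; apply: aug_ext => h.
by rewrite /delta -big_split; apply: eq_bigr => v _; rewrite mulrDr.
Qed.

Lemma aug_cat l1 l2 y : aug (l1 ++ l2) y = aug l2 (aug l1 y).
Proof. exact: foldl_cat. Qed.

Lemma delta_aug x l y g : delta x (aug l y) g = (-1) ^+ size l * aug l (delta x y) g.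
Proof.
elim: l y => [|z l IH] y /=; first by rewrite mul1r.
rewrite IH exprSr -mulrA mulN1r; congr (_ * _); rewrite -mulN1r -augZ.
by apply: aug_ext => h; rewrite mulN1r; apply: delta_anticomm.
Qed.

(** Bringing the two operators together across [l2] costs the same sign on both sides, so a single
    anticommutation remains. *)
Lemma aug_swap l1 l2 l3 x z y g :
  aug (l1 ++ x :: l2 ++ z :: l3) y g = - aug (l1 ++ z :: l2 ++ x :: l3) y g.
Proof.
rewrite !aug_cat /= !aug_cat /= -mulN1r -augZ; apply: aug_ext => h.
rewrite !delta_aug [RHS]mulrCA; congr (_ * _); rewrite -augZ; apply: aug_ext => h'.
by rewrite mulN1r; apply: delta_anticomm.
Qed.

Lemma map_tperm_id (x z : X) l : x \notin l -> z \notin l -> map (tperm x z) l = l.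
Proof.
move=> xl zl; rewrite -[RHS]map_id; apply/eq_in_map => c cl.
by rewrite tpermD //; apply: contraTneq cl => <-.
Qed.

Lemma aug_tperm l x z y g : x != z -> uniq l -> x \in l -> z \in l ->
  aug (map (tperm x z) l) y g = - aug l y g.
Proof.
have swp l1 l2 l3 (a b : X) : uniq (l1 ++ a :: l2 ++ b :: l3) ->
    aug (map (tperm a b) (l1 ++ a :: l2 ++ b :: l3)) y g =
    - aug (l1 ++ a :: l2 ++ b :: l3) y g.
  rewrite -aug_swap => U0; have : uniq (a :: b :: l1 ++ l2 ++ l3).
    rewrite -(perm_uniq (s1 := l1 ++ a :: l2 ++ b :: l3)) //.
    by apply/seq.permP => p; rewrite /= !count_cat /= !count_cat /=; lia.
  rewrite /= inE !mem_cat !negb_or.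
  case/andP=> /and4P[ab al1 al2 al3] /andP[/and3P[bl1 bl2 bl3] _].
  by rewrite map_cat /= map_cat /= tpermL tpermR !map_tperm_id.
move=> xz Ul xl; case/splitPr: xl Ul => l1 l2 Ul.
rewrite mem_cat inE eq_sym (negPf xz) /= => /orP[] zl; last first.
  by case/splitPr: zl Ul => l2' l3; apply: swp.
by case/splitPr: zl Ul => l1' l3; rewrite -catA /= tpermC; apply: swp.
Qed.

(** This yields the sign of the bijection of X in the augmentation. The list contains every point,
    so that both ends of each transposition in a decomposition of [p] occur in it. *)
Lemma aug_perm (p : {perm X}) l y g : uniq l -> (forall x, x \in l) ->
  aug (map p l) y g = (-1) ^+ p * aug l y g.
Proof.
have [ts -> tsP] := prod_tpermP p; elim: ts tsP l => [_|t ts IH /andP[t12 tsP]] l Ul lT.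
  rewrite big_nil odd_perm1 mul1r (_ : map _ l = l) // -[RHS]map_id.
  by apply: eq_map => x; rewrite perm1.
rewrite big_cons odd_permM odd_tperm (t12 : t.1 != t.2) signr_addb expr1 -mulrA mulrCA mulN1r.
rewrite -(aug_tperm y g t12 Ul (lT _) (lT _)) -IH //.
- congr (aug _ y g); rewrite -map_comp; apply: eq_map => x /=; exact: permM.
- by rewrite map_inj_uniq //; apply: perm_inj.
by move=> x; rewrite -[x](tpermK t.1 t.2) map_f.
Qed.
End Augmentation.

Section Transport.
Variables (k : fieldType) (X U : finType).
Local Notation pfun := {ffun U -> option X}.
Implicit Types (g : pfun) (x z : X) (y a : pfun -> k) (f : bij X X * bij U U).

(** The inverses appear because coefficients are pulled back: on basis elements [f] acts by sending
    h to f.1 h f.2, with [f.2] on the right as an arrow of the opposite category. *)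
Definition transport f g : pfun := [ffun u => omap (sval (binv f.1)) (g (sval (binv f.2) u))].

Lemma transportE f g u : transport f g (sval f.2 u) = omap (sval (binv f.1)) (g u).
Proof. by rewrite ffunE bijK. Qed.

Lemma stars_transport f g : stars (transport f g) = sval f.2 @: stars g.
Proof.
apply/setP => u; rewrite -[u](binvK f.2) -mem_bij_imset !mem_stars transportE.
by case: (g _).
Qed.

Lemma card_stars_transport f g : #|stars (transport f g)| = #|stars g|.
Proof. by rewrite stars_transport card_imset //; apply: (@Defs.bij_inj _ _ f.2). Qed.

Lemma pim_transport f g : pim (transport f g) = sval (binv f.1) @: pim g.
Proof.
apply/setP => x; apply/pimP/imsetP => [[u]|[z /pimP[u gu] ->]].
  by rewrite ffunE; case E: (g _) => [z|] //= [<-]; exists z => //; apply: mem_pim E.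
by exists (sval f.2 u); rewrite transportE gu.
Qed.

Lemma pim_transportT f g : (pim (transport f g) == setT) = (pim g == setT).
Proof.
rewrite pim_transport !eqEcard !subsetT /= card_imset //; apply: (@Defs.bij_inj _ _ (binv f.1)).
Qed.

Lemma transport_upd f g v x :
  transport f (upd g v (Some x)) =
  upd (transport f g) (sval f.2 v) (Some (sval (binv f.1) x)).
Proof.
apply/ffunP => u; rewrite -[u](binvK f.2); move: (sval (binv f.2) u) => {}u.
have [->|uv] := eqVneq u v; first by rewrite transportE !upd_eq.
by rewrite transportE !upd_neq ?transportE // (inj_eq (@Defs.bij_inj _ _ f.2)).
Qed.

Lemma transport_none f : transport f [ffun=> None] = [ffun=> None].
Proof. by apply/ffunP => u; rewrite !ffunE. Qed.

Definition vact f y g : k := rsign k f.2 (stars g) * y (transport f g).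

Lemma delta_vact x f y g :
  delta x (vact f y) g = vact f (delta (sval (binv f.1) x) y) g.
Proof.
rewrite /vact /delta mulr_sumr stars_transport big_imset /=; last first.
  by move=> u v _ _; apply: (@Defs.bij_inj _ _ f.2).
apply: eq_bigr => v vS; rewrite stars_upd transport_upd !mulrA; congr (_ * _).
rewrite (rsign_osign k f.2 vS) mulrAC; congr (_ * _).
by rewrite -mulrA osign_sqr mulr1.
Qed.

Lemma kdiff_vact f y g : kdiff setT (vact f y) g = vact f (kdiff setT y) g.
Proof.
rewrite /kdiff {2}/vact mulr_sumr (eq_bigl xpredT) => [|x]; last by rewrite inE.
rewrite [RHS](eq_bigl xpredT) => [|x]; last by rewrite inE.
rewrite [RHS](reindex_inj (@Defs.bij_inj _ _ (binv f.1))); apply: eq_bigr => x _.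
exact: delta_vact.
Qed.

Lemma aug_vact l f y g :
  aug l (vact f y) g = vact f (aug (map (sval (binv f.1)) l) y) g.
Proof.
elim: l y g => [|x l IH] y g //=; rewrite -IH.
by apply: aug_ext => h; apply: delta_vact.
Qed.

(** At the map without values all points of U are stars, whence the sign of [f.2]; renaming values
    reorders the list of points of X, whence the sign of [f.1]. *)
Lemma aug_vact_enum f y :
  aug (enum X) (vact f y) [ffun=> None] =
  bij_sign k f.1 * bij_sign k f.2 * aug (enum X) y [ffun=> None].
Proof.
rewrite aug_vact /vact transport_none (_ : stars _ = setT) ?rsign_setT; last first.
  by apply/setP => u; rewrite !inE ffunE.
rewrite (_ : map _ _ = map (bij_perm f.1)^-1%g (enum X)); last first.
  apply: eq_map => x; apply: (@perm_inj _ (bij_perm f.1)).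
  by rewrite permKV bij_perm_aut binvK.
rewrite aug_perm ?enum_uniq // => [|x]; last by rewrite mem_enum.
by rewrite odd_permV mulrCA mulrA.
Qed.

Lemma transport_id g : transport (bij_id X, bij_id U) g = g.
Proof.
apply/ffunP => u; have := transportE (bij_id X, bij_id U) g u.
rewrite /= ffunE => ->; case: (g u) => //= x; congr Some.
by rewrite -[RHS](bijK (bij_id X)) /= [in RHS]ffunE.
Qed.

Lemma transport_comp f f' g :
  transport (Defs.bij_comp f'.1 f.1, Defs.bij_comp f.2 f'.2) g =
  transport f (transport f' g).
Proof.
set h := (_, _); apply/ffunP => u; rewrite -[u](binvK h.2).
move: (sval (binv h.2) u) => {}u; rewrite transportE.
have -> : sval h.2 u = sval f.2 (sval f'.2 u) by rewrite ffunE.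
rewrite !transportE; case: (g u) => //= x; congr Some.
apply: (@Defs.bij_inj _ _ h.1); rewrite binvK.
have hE z : sval h.1 z = sval f'.1 (sval f.1 z) by rewrite ffunE.
by rewrite hE !binvK.
Qed.

Lemma rsign_id B : rsign k (bij_id U) B = 1.
Proof.
have h u : (u \in B) = (sval (bij_id U) u \in B) by rewrite ffunE.
rewrite -(rsignE k h) (_ : restr h = bij_id (subs B)) ?bij_sign1 //.
by apply: val_inj; apply/ffunP => u; apply: val_inj; rewrite [LHS]restrE !ffunE.
Qed.

Lemma rsign_comp (s t : bij U U) B :
  rsign k (Defs.bij_comp t s) B = rsign k t (sval s @: B) * rsign k s B.
Proof.
have h u : (u \in B) = (sval (Defs.bij_comp t s) u \in sval t @: (sval s @: B)).
  by rewrite ffunE -!mem_bij_imset.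
rewrite -(rsignE k h) -bij_signM; congr bij_sign; apply: val_inj.
by apply/ffunP => u; apply: val_inj; rewrite [LHS]restrE !ffunE /= ?ffunE.
Qed.

Lemma vact_id y g : vact (bij_id X, bij_id U) y g = y g.
Proof. by rewrite /vact transport_id rsign_id mul1r. Qed.

Lemma vact_comp f f' y g :
  vact (Defs.bij_comp f'.1 f.1, Defs.bij_comp f.2 f'.2) y g = vact f' (vact f y) g.
Proof.
by rewrite {1}/vact transport_comp rsign_comp -stars_transport [X in X * _]mulrC -mulrA.
Qed.
End Transport.

(** * Classes in the Grothendieck group *)

Section GrothendieckGroup.
Variables (k : fieldType) (C : category).
Implicit Types (M N : module k C) (p q r : K0 k C).

#[global] Instance K0eq_equiv : Equivalence (@K0eq k C).
Proof. by split; [exact: K0eq_refl | exact: K0eq_sym | exact: K0eq_trans]. Qed.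
#[global] Instance K0add_proper : Proper (@K0eq k C ==> @K0eq k C ==> @K0eq k C) (@K0add k C).
Proof. by move=> p p' pp' q q' qq'; apply: K0eq_add. Qed.
#[global] Instance K0opp_proper : Proper (@K0eq k C ==> @K0eq k C) (@K0opp k C).
Proof. by move=> p p' pp'; apply: K0eq_opp. Qed.

#[local] Hint Resolve K0eq_refl : core.
Local Open Scope K0_scope.

Lemma K0addr0 p : p + 0 =K0 p.
Proof. by rewrite K0eq_addC K0eq_add0. Qed.
Lemma K0addrN p : p + - p =K0 0.
Proof. by rewrite K0eq_addC K0eq_addN. Qed.
Lemma K0addrI p q r : p + q =K0 p + r -> q =K0 r.
Proof.
move=> pqr; rewrite -(K0eq_add0 q) -(K0eq_addN p) -K0eq_addA pqr K0eq_addA.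
by rewrite K0eq_addN K0eq_add0.
Qed.
Lemma K0oppD p q : - (p + q) =K0 - p + - q.
Proof.
apply: (@K0addrI (p + q)); rewrite K0addrN -K0eq_addA (K0eq_addCA q).
by rewrite K0addrN K0addr0 K0addrN.
Qed.
Lemma K0opp0 : - (0 : K0 k C) =K0 0.
Proof. by apply: (@K0addrI 0); rewrite K0addrN K0eq_add0. Qed.

Lemma K0sgn_proper n p q : p =K0 q -> K0sgn n p =K0 K0sgn n q.
Proof. by rewrite /K0sgn; case: odd => // ->. Qed.
#[global] Instance K0sgn_instance n : Proper (@K0eq k C ==> @K0eq k C) (@K0sgn k C n).
Proof. by move=> p q; apply: K0sgn_proper. Qed.
Lemma K0sgnD n p q : K0sgn n (p + q) =K0 K0sgn n p + K0sgn n q.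
Proof. by rewrite /K0sgn; case: odd=> //; exact: K0oppD. Qed.
Lemma K0sgnS n p : K0sgn n p + K0sgn n.+1 p =K0 0.
Proof. by rewrite /K0sgn /=; case: odd; [exact: K0eq_addN | exact: K0addrN]. Qed.

Lemma K0sum_rcons (s : seq nat) n (c : nat -> K0 k C) :
  K0sum (rcons s n) c =K0 K0sum s c + c n.
Proof.
elim: s => [|i s IH] /=; first by rewrite K0addr0 K0eq_add0.
by rewrite IH K0eq_addA.
Qed.

(** [z] stands for cycles and [b t] for boundaries in degree [t], which agree for [0 < t]. The last
    term [b d.+1] is left free, so that the homology in the top degree can be put there. *)
Lemma K0_telescope (c z b : nat -> K0 k C) d :
  (forall t, (t <= d)%N -> c t =K0 z t + b t.+1) ->
  (forall t, (0 < t <= d)%N -> z t =K0 b t) ->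
  K0sum (iota 0 d.+1) (fun t => K0sgn t (c t)) =K0 z 0%N + K0sgn d (b d.+1).
Proof.
elim: d => [|d IH] cE zE; first by rewrite /= K0addr0; exact: cE.
rewrite -addn1 iotaD cats1 add0n K0sum_rcons IH; last 2 first.
- by move=> t td; apply/cE/leqW.
- by move=> t /andP[t0 td]; apply: zE; rewrite t0 leqW.
rewrite (cE _ (leqnn _)) K0sgnD (zE d.+1) ?leqnn //.
by rewrite -K0eq_addA (K0eq_addA (K0sgn d _)) K0sgnS K0eq_add0 addn1.
Qed.

(** Both maps of the sequence M -> M -> M may be the identity, so [M] = [M] + [M]. *)
Lemma K0_null M : (forall x (v : M x), v = 0%R) -> [cls M] =K0 0.
Proof.
move=> M0; apply: (@K0addrI [cls M]); rewrite K0addr0; symmetry.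
have idn x y (f : arr x y) v : \1%VF (mact M f v) = mact M f (\1%VF v).
  by rewrite !id_lfunE.
have v0 x (A B : {vspace M x}) : A = B.
  by apply/vspaceP => v; rewrite (M0 x v) !mem0v.
pose id_M := @Modmor _ _ M M (fun=> \1%VF) idn.
by apply: K0eq_ses; exists id_M, id_M.
Qed.

Lemma K0_iso M N (a : modmor M N) :
  (forall x, lker (a x) = 0%VS) -> (forall x, limg (a x) = fullv) ->
  [cls M] =K0 [cls N].
Proof.
move=> a0 aT; pose Z := @Module k C (fun=> 'rV[k]_0) (fun _ _ _ => \1%VF)
  (fun _ v => id_lfunE v) (fun _ _ _ _ _ v => esym (id_lfunE _)).
have Z0 x (v : Z x) : v = 0%R by apply/rowP; case.
have /K0_null Z0' := Z0.
have bn x y (f : arr x y) v :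
    (0%R : 'Hom(N y, Z y)) (mact N f v) = mact Z f ((0%R : 'Hom(N x, Z x)) v).
  by rewrite !zero_lfunE linear0.
rewrite -(K0addr0 [cls M]) -Z0'; symmetry.
apply: K0eq_ses; exists a, (Modmor bn) => x; split=> //.
  by rewrite aT; apply/vspaceP => v; rewrite memvf memv_ker zero_lfunE eqxx.
by apply/vspaceP => v; rewrite (Z0 _ v) !mem0v.
Qed.

Section Image.
Variables (M N : module k C) (a : modmor M N).

(** The first isomorphism theorem for the restriction of [a] to [W]. Kernel and image are given up
    to equality, each with its own stability proof, so that consecutive degrees of the complex share
    the same submodules. *)
Lemma K0_image (W K : forall x, {vspace M x}) (I : forall x, {vspace N x})
    (hW : forall x y (f : arr x y) v, v \in W x -> mact M f v \in W y)
    (hK : forall x y (f : arr x y) v, v \in K x -> mact M f v \in K y)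
    (hI : forall x y (f : arr x y) v, v \in I x -> mact N f v \in I y) :
  (forall x, K x = (W x :&: lker (a x))%VS) ->
  (forall x, I x = (a x @: W x)%VS) ->
  [cls submod hW] =K0 [cls submod hK] + [cls submod hI].
Proof.
move=> KE IE.
have KW x v : v \in K x -> v \in W x by rewrite KE memv_cap => /andP[].
have WI x v : v \in W x -> a x v \in I x by move=> vW; rewrite IE memv_img.
pose al x : 'Hom(subvs_of (K x), subvs_of (W x)) :=
  linfun (fun v => vsproj (W x) (vsval v)).
have alE x v : vsval (al x v) = vsval v.
  by rewrite linfunE ?vsprojK ?KW ?subvsP // => c u w; rewrite !linearP.
pose be x : 'Hom(subvs_of (W x), subvs_of (I x)) :=
  linfun (fun v => vsproj (I x) (a x (vsval v))).
have beE x v : vsval (be x v) = a x (vsval v).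
  by rewrite linfunE ?vsprojK ?WI ?subvsP // => c u w; rewrite !linearP.
have aln x y (f : arr x y) v :
    al y (mact (submod hK) f v) = mact (submod hW) f (al x v).
  apply: val_inj; apply: (etrans (alE _ _)).
  apply: (etrans (submod_actE hK f v)); apply/esym/(etrans (submod_actE hW f _)).
  by rewrite alE.
have ben x y (f : arr x y) v :
    be y (mact (submod hW) f v) = mact (submod hI) f (be x v).
  apply: val_inj; apply: (etrans (beE _ _)).
  rewrite (submod_actE hW f v) mmap_nat; apply/esym/(etrans (submod_actE hI f _)).
  by rewrite beE.
apply: K0eq_ses; exists (@Modmor _ _ (submod hK) (submod hW) al aln).
exists (@Modmor _ _ (submod hW) (submod hI) be ben) => x; split=> /=.
- apply/vspaceP => v; rewrite memv_ker memv0; apply/eqP/eqP => [alv|->]; last exact: linear0.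
  by apply: val_inj; rewrite /= -alE alv.
- apply/vspaceP => v; rewrite memv_ker; apply/memv_imgP/eqP => [[u _ ->]|bv].
    apply: val_inj; apply: (etrans (beE _ _)); rewrite alE; apply/eqP.
    have KP w : w \in K x -> a x w == 0%R by rewrite KE memv_cap memv_ker => /andP[].
    exact: KP (subvsP u).
  have av : a x (vsval v) = 0%R by rewrite -beE bv.
  have vK : vsval v \in K x by rewrite KE memv_cap subvsP memv_ker av eqxx.
  exists (vsproj (K x) (vsval v)); rewrite ?memvf //.
  by apply/esym/val_inj/(etrans (alE _ _)); rewrite vsprojK.
apply/vspaceP => v; rewrite memvf; apply/memv_imgP.
have IP w : w \in I x -> exists2 v, v \in W x & w = a x v.
  by rewrite IE => /memv_imgP.
have [w wW vE] := IP _ (subvsP v).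
exists (vsproj (W x) w); rewrite ?memvf //.
by apply/esym/val_inj/(etrans (beE _ _)); rewrite vsprojK.
Qed.

Lemma K0_embed (I : forall x, {vspace N x})
    (hI : forall x y (f : arr x y) v, v \in I x -> mact N f v \in I y) :
  (forall x, lker (a x) = 0%VS) -> (forall x, I x = limg (a x)) ->
  [cls M] =K0 [cls submod hI].
Proof.
move=> a0 IE.
pose be x : 'Hom(M x, subvs_of (I x)) := linfun (fun v => vsproj (I x) (a x v)).
have beE x v : vsval (be x v) = a x v.
  by rewrite linfunE ?vsprojK ?IE ?memv_img ?memvf // => c u w; rewrite !linearP.
have ben x y (f : arr x y) v : be y (mact M f v) = mact (submod hI) f (be x v).
  apply/val_inj/(etrans (beE _ _)); rewrite mmap_nat.
  by apply/esym/(etrans (submod_actE hI f _)); rewrite beE.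
apply: (@K0_iso _ _ (@Modmor _ _ M (submod hI) be ben)) => x /=.
  apply/vspaceP => v; rewrite -(a0 x) !memv_ker; apply/eqP/eqP => [bv|av].
    by rewrite -beE bv.
  by apply/val_inj/(etrans (beE _ _)).
apply/vspaceP => v; rewrite memvf; apply/memv_imgP.
have IP w : w \in I x -> exists v, w = a x v.
  by rewrite IE => /memv_imgP[v' _ ->]; exists v'.
have [w vE] := IP _ (subvsP v).
by exists w; rewrite ?memvf //; apply/esym/val_inj/(etrans (beE _ _)).
Qed.
End Image.

Lemma K0_surj M N (a : modmor M N) (W K : forall x, {vspace M x})
    (hW : forall x y (f : arr x y) v, v \in W x -> mact M f v \in W y)
    (hK : forall x y (f : arr x y) v, v \in K x -> mact M f v \in K y) :
  (forall x, K x = (W x :&: lker (a x))%VS) ->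
  (forall x, (a x @: W x)%VS = fullv) ->
  [cls submod hW] =K0 [cls submod hK] + [cls N].
Proof.
move=> KE aW.
have idn x y (f : arr x y) v : \1%VF (mact N f v) = mact N f (\1%VF v).
  by rewrite !id_lfunE.
have hT x y (f : arr x y) v : v \in (fullv : {vspace N x}) -> mact N f v \in fullv.
  by move=> _; apply: memvf.
have -> : [cls N] =K0 [cls submod hT].
  apply: (K0_embed (a := @Modmor _ _ N N (fun=> \1%VF) idn)) => x /=.
    by apply/vspaceP => v; rewrite memv_ker memv0 id_lfunE.
  by rewrite lim1g.
by apply: K0_image KE _ => x; rewrite aW.
Qed.
End GrothendieckGroup.

(** * The Koszul complex of representations *)

Section KoszulModule.
Variables (k : fieldType) (X U : finType).
Local Notation pfun := {ffun U -> option X}.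
Local Notation D := (@full1 FBFBop (X, U)).
Local Notation V := (kfree k pfun).
Implicit Types (g h : pfun) (u v w : U) (x z : X) (y a : V) (f : bij X X * bij U U).

Lemma linfun_ffunE (W : vectType k) (T : finType) (F : W -> T -> k) (w : W) t :
  (forall c p q t, F (c *: p + q) t = c * F p t + F q t) ->
  linfun (fun w : W => [ffun t => F w t] : kfree k T) w t = F w t.
Proof.
by move=> FL; rewrite linfunE ?ffunE // => c p q; apply/ffunP => s; rewrite !ffunE FL.
Qed.

Definition koszul_act f : 'End(V) := linfun (fun y => [ffun g => @vact k X U f y g] : V).
Lemma koszul_actE f y g : koszul_act f y g = @vact k X U f y g.
Proof.
rewrite linfun_ffunE // => c p q h; rewrite /vact !ffunE mulrDr.
by rewrite [c *: _]/(c * _) mulrCA.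
Qed.

Fact koszul_act1 (i : D) y : koszul_act (@idc D i) y = y.
Proof. by apply/ffunP => g; rewrite koszul_actE; apply: vact_id. Qed.
Fact koszul_actM (i j l : D) (f' : @arr D j l) (f : @arr D i j) y :
  koszul_act (cmp f' f) y = koszul_act f' (koszul_act f y).
Proof.
apply/ffunP => g; rewrite !koszul_actE; apply: (etrans (vact_comp _ _ _ _)).
by rewrite /vact koszul_actE.
Qed.

Definition koszul : module k D :=
  @Module k D (fun=> V) (fun _ _ f => koszul_act f) koszul_act1 koszul_actM.

(** The cut-off discards the maps that lost a value: it presents the quotient complex as functions
    supported on the maps onto X. *)
Definition diff : 'End(V) :=
  linfun (fun y => [ffun g => if pim g == setT then @kdiff k X U setT y g else 0] : V).
Lemma diffE y g : diff y g = if pim g == setT then @kdiff k X U setT y g else 0.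
Proof.
rewrite linfun_ffunE // => c p q h; case: ifP => _; last by rewrite mulr0 addr0.
by rewrite -kdiff_lin; apply: eq_kdiff => w x _ _; rewrite !ffunE.
Qed.

Definition augL : 'Hom(V, k^o) :=
  linfun (fun y => @aug k X U (enum X) y [ffun=> None] : k^o).
Lemma augLE y : augL y = @aug k X U (enum X) y [ffun=> None].
Proof.
rewrite linfunE // => c p q.
rewrite -[RHS]/(c * aug _ p _ + aug _ q _) -augZ -augD.
by apply: aug_ext => h; rewrite !ffunE.
Qed.

Lemma diff_nat (i j : D) (f : @arr D i j) y :
  diff (mact koszul f y) = mact koszul f (diff y).
Proof.
apply/ffunP => g; rewrite koszul_actE diffE /vact diffE pim_transportT.
case: ifP => _; last by rewrite mulr0.
rewrite -[RHS]/(vact f _ g) -kdiff_vact; apply: eq_kdiff => v x _ _.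
exact: koszul_actE.
Qed.
Definition diffM : modmor koszul koszul :=
  @Modmor k D koszul koszul (fun=> diff) diff_nat.

Definition sign_act f : 'End(k^o) :=
  linfun (fun c : k^o => bij_sign k f.1 * bij_sign k f.2 * c : k^o).
Lemma sign_actE f c : sign_act f c = bij_sign k f.1 * bij_sign k f.2 * c.
Proof. by rewrite linfunE // => b p q; rewrite mulrDr [b *: _]/(b * _) mulrCA. Qed.
Fact sign_act1 (i : D) c : sign_act (@idc D i) c = c.
Proof. by rewrite sign_actE /= !bij_sign1 !mul1r. Qed.
Fact sign_actM (i j l : D) (f' : @arr D j l) (f : @arr D i j) c :
  sign_act (cmp f' f) c = sign_act f' (sign_act f c).
Proof.
rewrite !sign_actE /= !bij_signM [RHS]mulrA; congr (_ * _).
by rewrite [RHS]mulrACA; congr (_ * _); apply: mulrC.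
Qed.
Definition signmod : module k D :=
  @Module k D (fun=> k^o) (fun _ _ f => sign_act f) sign_act1 sign_actM.

Lemma aug_nat (i j : D) (f : @arr D i j) y :
  augL (mact koszul f y) = mact signmod f (augL y).
Proof.
rewrite sign_actE !augLE -aug_vact_enum; apply: aug_ext => h; exact: koszul_actE.
Qed.
Definition augM : modmor koszul signmod :=
  @Modmor k D koszul signmod (fun=> augL) aug_nat.

Definition mask (P : pred pfun) : 'End(V) :=
  linfun (fun y => [ffun g => if P g then 0 else y g] : V).
Lemma maskE P y g : mask P y g = if P g then 0 else y g.
Proof.
rewrite linfun_ffunE // => c p q h; rewrite !ffunE.
by case: ifP; rewrite ?mulr0 ?addr0.
Qed.

Definition kcell t g := (pim g == setT) && (#|stars g| == t).

Definition kspace t : {vspace V} := lker (mask (kcell t)).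

Lemma kspaceP t y : reflect (forall g, ~~ kcell t g -> y g = 0) (y \in kspace t).
Proof.
rewrite memv_ker; apply: (iffP eqP) => [m0 g gN|y0].
  by have := congr1 (fun y : V => y g) m0; rewrite maskE (negPf gN) ffunE.
apply/ffunP => g; rewrite maskE [RHS]ffunE; case: ifPn => // ; exact: y0.
Qed.

Lemma kcell_transport t f g : kcell t (transport f g) = kcell t g.
Proof. by rewrite /kcell pim_transportT card_stars_transport. Qed.

Lemma kspace_stable t (i j : D) (f : @arr D i j) y :
  y \in kspace t -> mact koszul f y \in kspace t.
Proof.
move=> /kspaceP yt; apply/kspaceP => g gt.
by rewrite koszul_actE /vact yt ?mulr0 // kcell_transport.
Qed.

Lemma diff_kspace t y : y \in kspace t -> diff y \in kspace t.+1.
Proof.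
move=> /kspaceP yt; apply/kspaceP => g; rewrite diffE /kcell.
case: eqP => //= _ gt; rewrite /kdiff big1 // => x _; apply: big1 => v vS.
rewrite yt ?mulr0 // /kcell stars_upd negb_and; apply/orP; right.
by move: gt; rewrite (cardsD1 v (stars g)) vS eqSS.
Qed.

Lemma pim_updT g v x : v \in stars g -> pim g = setT -> pim (upd g v (Some x)) = setT.
Proof. by move=> vS gT; rewrite pim_upd // gT setUT. Qed.

Hypothesis char0 : [pchar k] =i pred0.

Lemma diff_sqr y : diff (diff y) = 0.
Proof.
apply/ffunP => g; rewrite diffE [RHS]ffunE; case: eqP => // gT.
rewrite -[RHS](kdiff_sqr char0 setT y g); apply: eq_kdiff => v x vS _.
by rewrite diffE pim_updT // eqxx.
Qed.

Lemma two_neq0 : 2%:R != 0 :> k. Proof. by rewrite (pcharf0P k).1. Qed.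

(** Exchanging the two occurrences of [x] changes the sign and leaves the list of operators
    unchanged. *)
Lemma aug_delta_mem (l : seq X) x (y : pfun -> k) g :
  x \in l -> aug l (delta x y) g = 0.
Proof.
case/splitPr=> l1 l2; have := aug_swap [::] l1 l2 x x y g.
move/eqP; rewrite -addr_eq0 -mulr2n -mulr_natr mulf_eq0 (negPf two_neq0) orbF.
by move/eqP.
Qed.

(** The differential is the sum of the [delta x] over X, and the augmentation applies each of these
    operators once more. *)
Lemma augL_diff y : augL (diff y) = 0.
Proof.
rewrite augLE; have -> : @aug k X U (enum X) (diff y) [ffun=> None] =
    @aug k X U (enum X) (@kdiff k X U setT y) [ffun=> None].
  apply: eq_aug => h hT; rewrite diffE hT.
  rewrite (_ : [set x in enum X] = setT) ?setUT ?eqxx //.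
  by apply/setP => x; rewrite !inE mem_enum.
have augS (s : seq X) :
    @aug k X U (enum X) (fun g => \sum_(x <- s) @delta k X U x y g) [ffun=> None] = 0.
  elim: s => [|x s IH].
    rewrite -[RHS](mul0r (@aug k X U (enum X) y [ffun=> None])) -augZ.
    by apply: aug_ext => h; rewrite big_nil mul0r.
  rewrite -[RHS]IH -[RHS]add0r -[X in _ = X + _](aug_delta_mem y [ffun=> None] (mem_enum X x)).
  by rewrite -augD; apply: aug_ext => h; rewrite big_cons.
rewrite -(augS (enum X)); apply: aug_ext => h.
by rewrite /kdiff big_enum; apply: eq_bigl => x; rewrite !inE.
Qed.

Lemma diff_exact t y : y \in kspace t.+1 -> diff y = 0 -> augL y = 0 ->
  exists2 b, b \in kspace t & y = diff b.
Proof.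
move=> /kspaceP yt dy0; rewrite augLE => augy.
have eT : [set x in enum X] = setT by apply/setP => x; rewrite !inE mem_enum.
have [||b] := @kdiff_exact k X U char0 (enum X) y (enum_uniq _) _ _ augy.
- rewrite eT => g gT; have := congr1 (fun y : V => y g) dy0.
  by rewrite diffE gT eqxx ffunE.
- by move=> g _ g0; rewrite yt // /kcell g0 cards0 andbF.
(* The chain [b] may mix degrees. As the differential raises the number of stars by one, the part
   with [t] stars alone accounts for degree [t.+1]. *)
rewrite eT => bE; pose b' : V := [ffun g => if kcell t g then b g else 0].
exists b'; first by apply/kspaceP => g gt; rewrite ffunE (negPf gt).
apply/ffunP => g; rewrite diffE; case: eqP => gT; last first.
  by rewrite yt // /kcell (introF eqP gT).
have [gt|gt] := boolP (kcell t.+1 g).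
  rewrite bE //; apply: eq_kdiff => v x vS _; rewrite ffunE /kcell pim_updT // eqxx stars_upd.
  by move: gt; rewrite /kcell gT eqxx (cardsD1 v (stars g)) vS eqSS => ->.
rewrite yt // /kdiff big1 // => x _; apply: big1 => v vS.
rewrite ffunE /kcell pim_updT // eqxx stars_upd; case: eqP => [st|]; rewrite ?mulr0 //.
by move: gt; rewrite /kcell gT eqxx (cardsD1 v (stars g)) vS st eqxx.
Qed.

Lemma card_pimT g : pim g = setT -> (#|X| + #|stars g| <= #|U|)%N.
Proof.
move=> gT; rewrite -(cardsC (stars g)) addnC leq_add2l.
apply: leq_trans (leq_imset_card g _); rewrite -cardsT -(card_imset _ Some_inj).
apply/subset_leq_card/subsetP => _ /imsetP[x _ ->].
have /pimP[v gv] : x \in pim g by rewrite gT.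
by rewrite -gv imset_f // !inE gv.
Qed.

Lemma aug_eq0 (l : seq X) (y : pfun -> k) g :
  (forall h, (#|stars h| + size l = #|stars g|)%N -> y h = 0) -> aug l y g = 0.
Proof.
elim: l y => [|x l IH] y y0 /=; first by rewrite y0 ?addn0.
apply: IH => h hg; apply: big1 => v vS; rewrite y0 ?mulr0 // stars_upd -hg.
by rewrite /= (cardsD1 v (stars h)) vS addnS.
Qed.

Lemma augL_kspace t y : y \in kspace t -> (#|X| + t != #|U|)%N -> augL y = 0.
Proof.
move=> /kspaceP yt tU; rewrite augLE; apply: aug_eq0 => h.
rewrite (_ : stars [ffun=> None] = setT) ?cardsT => [hU|]; last first.
  by apply/setP => u; rewrite !inE ffunE.
rewrite yt // /kcell negb_and; apply/orP; right.
by apply: contraNneq tU => <-; rewrite -hU -cardE addnC.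
Qed.

Lemma delta_basis x h u g : h u = Some x -> (forall v, h v = Some x -> v = u) ->
  delta x (kbasis k h) g =
  osign k (u |: stars h) u * kbasis k (upd h u None) g.
Proof.
move=> hu hx; have [gE|gN] := eqVneq g (upd h u None).
  rewrite gE [X in _ * X]ffunE eqxx mulr1 /delta stars_updN big_setU1 ?mem_stars ?hu //=.
  rewrite upd_upd -{1}hu upd_id ffunE eqxx mulr1 big1 ?addr0 // => v vS.
  rewrite ffunE; case: eqP => [hE|_]; last exact: mulr0.
  have vu : v = u by apply: hx; rewrite -hE upd_eq.
  by rewrite vu mem_stars hu in vS.
rewrite [X in _ * X]ffunE (negPf gN) mulr0 /delta big1 // => v.
rewrite mem_stars ffunE => /eqP gv; case: eqP => [hE|_]; last exact: mulr0.
have vu : v = u by apply: hx; rewrite -hE upd_eq.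
by case/eqP: gN; rewrite -hE vu upd_upd -vu -gv upd_id.
Qed.

(** When each value is taken once, every [delta] turns a basis element into a single signed basis
    element, and the last one is the empty map. *)
Lemma aug_basis (l : seq X) h : uniq l -> pim h = [set x in l] ->
  (forall u v x, h u = Some x -> h v = Some x -> u = v) ->
  aug l (kbasis k h) [ffun=> None] != 0.
Proof.
elim: l h => [|x l IH] h /=.
  move=> _ h0 _; rewrite (_ : h = [ffun=> None]) ?ffunE ?eqxx ?oner_eq0 //.
  apply/ffunP => u; rewrite ffunE; case hu: (h u) => [x|//].
  by have := mem_pim hu; rewrite h0 inE.
move=> /andP[xl Ul] hE hI; have /pimP[u hu] : x \in pim h by rewrite hE !inE eqxx.
have -> : aug l (delta x (kbasis k h)) [ffun=> None] =
    aug l (fun g => osign k (u |: stars h) u * kbasis k (upd h u None) g) [ffun=> None].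
  by apply: aug_ext => g; apply: delta_basis => // v /hI; apply.
rewrite augZ mulf_neq0 ?IH //.
- by apply: contra_eq_neq (osign_sqr k (u |: stars h) u) => ->; rewrite mul0r eq_sym oner_eq0.
- apply/setP => z; rewrite inE; apply/pimP/idP => [[v]|zl].
    rewrite ffunE; case: eqP => // vu hv.
    have := mem_pim hv; rewrite hE !inE => /predU1P[zx|//].
    by case: vu; apply: hI hv _; rewrite zx.
  have /pimP[v hv] : z \in pim h by rewrite hE !inE zl orbT.
  exists v; rewrite upd_neq //; apply/eqP => vu; rewrite vu hu in hv.
  by case: hv xl => ->; rewrite zl.
move=> v w z; rewrite !ffunE; case: eqP => // _; case: eqP => // _; exact: hI.
Qed.

Lemma augL_surj : (#|X| <= #|U|)%N ->
  exists2 y, y \in kspace (#|U| - #|X|)%N & augL y != 0.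
Proof.
(* A copy of X in U; [h] below is its partial inverse, a bijection off the stars. *)
move=> XU; pose i x : U := enum_val (widen_ord XU (enum_rank x)).
have iI : injective i.
  by move=> x z /enum_val_inj/(congr1 val)/= xz; apply/enum_rank_inj/val_inj.
pose h : pfun := [ffun u => [pick x | i x == u]].
have hi x : h (i x) = Some x.
  by rewrite ffunE; case: pickP => [z /eqP/iI->//|/(_ x)]; rewrite eqxx.
have hiP u x : h u = Some x -> u = i x.
  by rewrite ffunE; case: pickP => // z /eqP <- [<-].
have hT : pim h = setT by apply/setP => x; rewrite in_setT (mem_pim (hi x)).
exists (kbasis k h).
  apply/kspaceP => g; rewrite ffunE; case: eqP => // ->.
  rewrite /kcell hT eqxx /= => /eqP[]; rewrite -[#|U|](cardsC (stars h)).
  suff -> : ~: stars h = i @: setT by rewrite card_imset // cardsT addnK.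
  apply/setP => u; rewrite in_setC mem_stars; apply/idP/imsetP => [|[x _ ->]].
    by case hu: (h u) => [x|//] _; exists x; rewrite ?inE ?(hiP _ _ hu).
  by rewrite hi.
rewrite augLE; apply: aug_basis; rewrite ?enum_uniq //.
  by rewrite hT; apply/setP => x; rewrite !inE mem_enum.
by move=> u v x /hiP -> /hiP ->.
Qed.
End KoszulModule.

(** * Identification of the terms *)

Section TensorCoordinates.
Variable k : fieldType.
Implicit Types V W : vectType k.

Lemma f2mx_resolution V (I : finType) (a : I -> 'Hom(V, k^o)) (b : I -> 'Hom(k^o, V)) :
  (forall v, v = \sum_i b i (a i v)) -> 1%:M = \sum_i f2mx (a i) *m f2mx (b i).
Proof.
move=> vE; apply/row_matrixP => i; rewrite !rowE mulmx1 mulmx_sumr.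
rewrite -[delta_mx 0 i]r2vK {1}[r2v _]vE linear_sum; apply: eq_bigr => j _.
by rewrite mulmxA -!v2r_lfun.
Qed.

(** Elements of a tensor product are matrices in unknown bases; factoring both identities through
    lines allows them to be tested on chosen coordinates. *)
Lemma tens_eq0 V W (I J : finType) (a : I -> 'Hom(V, k^o)) (b : I -> 'Hom(k^o, V))
    (c : J -> 'Hom(W, k^o)) (d : J -> 'Hom(k^o, W)) (x : tens V W) :
  (forall v, v = \sum_i b i (a i v)) -> (forall w, w = \sum_j d j (c j w)) ->
  (forall i j, tensmap (a i) (c j) x = 0) -> x = 0.
Proof.
move=> /f2mx_resolution vE /f2mx_resolution wE x0.
have -> : x = (\sum_i f2mx (a i) *m f2mx (b i))^T *m x *m
    (\sum_j f2mx (c j) *m f2mx (d j)).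
  by rewrite -vE -wE trmx1 mul1mx mulmx1.
rewrite [(\sum_i _)^T]linear_sum /= !mulmx_suml big1 // => i _.
rewrite mulmx_sumr big1 // => j _.
have := x0 i j; rewrite tensmapE => h.
rewrite trmx_mul -!mulmxA (mulmxA x) (mulmxA _ (x *m _)) (mulmxA _ x) h.
by rewrite mul0mx mulmx0.
Qed.

(* The coordinate isomorphism v2r of k^o is opaque: c1 is the unknown unit by which
   it differs from the obvious one. *)
Let one : k^o := 1.
Let c1 : k := v2r one 0 0.

Fact v2r_one_neq0 : c1 != 0.
Proof.
apply/eqP => c10; have : one = 0; last by move/eqP; rewrite oner_eq0.
by rewrite -[one]v2rK [v2r one](_ : _ = 0) ?linear0 //; apply/rowP => i; rewrite mxE (ord1 i).
Qed.

(** Each factor contributes [c1] to the matrix entry; dividing by its square gives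
    [tens_val (ptens a b) = a * b]. *)
Definition tens_val (x : tens (k^o : vectType k) (k^o : vectType k)) : k :=
  c1^-1 ^+ 2 * (x : 'M[k]_1) 0 0.

Lemma tens_val_linear (a : k) x y : tens_val (a *: x + y) = a * tens_val x + tens_val y.
Proof. by rewrite /tens_val !mxE mulrDr mulrCA. Qed.

Lemma tens_val_eq0 x : tens_val x = 0 -> x = 0.
Proof.
move/eqP; rewrite mulf_eq0 expf_eq0 /= invr_eq0 (negPf v2r_one_neq0) => /eqP x0.
by apply/matrixP => i j; rewrite (ord1 i) (ord1 j) mxE.
Qed.

Lemma tens_val_ptens (a b : k^o) : tens_val (ptens a b) = a * b.
Proof.
have vE (d : k^o) : v2r d 0 0 = d * c1.
  have dE : d = d *: one by rewrite [d *: one]mulr1.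
  by rewrite {1}dE linearZ mxE.
rewrite /tens_val /ptens mxE big_ord1 mxE !vE [X in _ * X]mulrACA [LHS]mulrCA -[c1 * c1]expr2.
by rewrite -exprMn mulVf ?v2r_one_neq0 // expr1n mulr1.
Qed.

Lemma f2mx_scale V W (s : k) (f f' : 'Hom(V, W)) :
  (forall v, f' v = s *: f v) -> f2mx f' = s *: f2mx f.
Proof.
move=> fE; apply/row_matrixP => i; rewrite linearZ /= !rowE -[delta_mx 0 i]r2vK.
by rewrite -!v2r_lfun fE linearZ.
Qed.

Lemma tens_val_scale (r s : k) V W (f f' : 'Hom(V, k^o)) (g g' : 'Hom(W, k^o)) (x : tens V W) :
  (forall v, f' v = r * f v) -> (forall w, g' w = s * g w) ->
  tens_val (tensmap f' g' x) = r * s * tens_val (tensmap f g x).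
Proof.
move=> fE gE; have -> : tensmap f' g' x = (r * s) *: tensmap f g x.
  rewrite !tensmapE (f2mx_scale fE) (f2mx_scale gE) linearZ /=.
  by rewrite [(r *: _)^T]linearZ /= -!scalemxAl scalerA mulrC.
by rewrite -[_ *: tensmap _ _ _]addr0 tens_val_linear /tens_val !mxE mulr0 addr0.
Qed.
End TensorCoordinates.

(** * The Day convolution as chains with t stars *)

Section DayKoszul.
Variables (k : fieldType) (X U : finType) (t : nat).
Local Notation pfun := {ffun U -> option X}.
Local Notation D := (@full1 FBFBop (X, U)).
Local Notation V := (kfree k pfun).
Implicit Types (A B : {set U}) (g : pfun) (u v : U).

Lemma card_subs A : #|subs A| = #|A|.
Proof. by rewrite card_sig; apply: eq_card => u; rewrite !inE. Qed.

Definition pext A (h : surj (subs A) X) : pfun :=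
  [ffun u => omap (sval h) (insub u : option (subs A))].

Lemma pext_in A (h : surj (subs A) X) (a : subs A) : pext h (sval a) = Some (sval h a).
Proof. by rewrite ffunE; case: a => u uA /=; rewrite insub_subs. Qed.
Lemma pext_notin A (h : surj (subs A) X) u : u \notin A -> pext h u = None.
Proof. by move=> uA; rewrite ffunE insubN. Qed.

Lemma stars_pext A (h : surj (subs A) X) : stars (pext h) = ~: A.
Proof.
apply/setP => u; rewrite mem_stars in_setC; have [uA|uA] /= := boolP (u \in A).
  by rewrite -[u]/(sval (exist (fun u => u \in A) u uA)) pext_in.
by rewrite pext_notin.
Qed.

Lemma pim_pext A (h : surj (subs A) X) : pim (pext h) = setT.
Proof.
apply/setP => x; rewrite in_setT; have /surjectiveP/(_ x)[a <-] := proj2_sig h.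
by apply: mem_pim (pext_in h a).
Qed.

Lemma pext_inj A : injective (@pext A).
Proof.
move=> h h' hh; apply: val_inj; apply/ffunP => a; apply: Some_inj.
by rewrite -!pext_in hh.
Qed.

Fact pext_onto_subproof g (gT : pim g = setT)
  (x0 : subs (~: stars g) -> X) (x0P : forall a, g (sval a) = Some (x0 a)) :
  surjectiveb [ffun a => x0 a].
Proof.
apply/surjectiveP => x; have /pimP[u gu] : x \in pim g by rewrite gT.
have uS : u \in ~: stars g by rewrite in_setC mem_stars gu.
exists (exist (fun u => u \in ~: stars g) u uS); rewrite ffunE.
by apply: Some_inj; rewrite -x0P.
Qed.

Lemma pext_onto g : pim g = setT -> exists A (h : surj (subs A) X), g = pext h.
Proof.
move=> gT; have gS (a : subs (~: stars g)) : {x | g (sval a) = Some x}.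
  case: a => u uS /=; case gu: (g u) => [x|]; first by exists x.
  by move: uS; rewrite in_setC mem_stars gu.
have hS := pext_onto_subproof gT (fun a => svalP (gS a)).
exists (~: stars g), (Surj hS); apply/ffunP => u.
have [uS|uS] := boolP (u \in ~: stars g); last first.
  by rewrite pext_notin //; move: uS; rewrite in_setC negbK mem_stars => /eqP.
rewrite -[u]/(sval (exist (fun u => u \in ~: stars g) u uS)) pext_in /= ffunE.
exact: (proj2_sig (gS (exist (fun u => u \in ~: stars g) u uS))).
Qed.

Definition kfree_eval (T : finType) (a : T) : 'Hom(kfree k T, k^o) :=
  linfun (fun x : kfree k T => (x a : k^o)).
Lemma kfree_evalE (T : finType) (a : T) x : kfree_eval a x = x a.
Proof. by rewrite linfunE // => c p q; rewrite !ffunE. Qed.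
Definition kfree_line (T : finType) (a : T) : 'Hom(k^o, kfree k T) :=
  linfun (fun c : k^o => (c : k) *: kbasis k a).
Lemma kfree_lineE (T : finType) (a : T) c : kfree_line a c = (c : k) *: kbasis k a.
Proof. by rewrite linfunE // => d p q; rewrite scalerDl scalerA. Qed.

Definition sgn_coord (S : finType) : 'Hom(sgn_obj k t S, k^o) :=
  linfun (fun v : sgn_obj k t S => (\sum_i v 0 i : k^o)).
Lemma sgn_coordE (S : finType) (v : sgn_obj k t S) :
  sgn_coord S v = \sum_i (v : 'rV_(#|S| == t)) 0 i.
Proof.
rewrite linfunE // => c p q; rewrite scaler_sumr -big_split.
by apply: eq_bigr => i _; rewrite !mxE.
Qed.
Definition sgn_vec (S : finType) : 'Hom(k^o, sgn_obj k t S) :=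
  linfun (fun c : k^o => const_mx (c : k) : sgn_obj k t S).
Lemma sgn_vecE (S : finType) (c : k^o) : sgn_vec S c = const_mx (c : k) :> 'rV_(#|S| == t).
Proof. by rewrite linfunE // => d p q; apply/rowP => i; rewrite !mxE. Qed.
Lemma sgn_coordK (S : finType) (v : sgn_obj k t S) : v = sgn_vec S (sgn_coord S v).
Proof.
apply/rowP => i; rewrite sgn_vecE mxE sgn_coordE; move: (v : 'rV_(#|S| == t)) i.
by case: (#|S| == t) => /= w i; [rewrite big_ord1 (ord1 i) | case: i].
Qed.
Lemma sgn_coord_vec (S : finType) : sgn_coord S (sgn_vec S 1) = (#|S| == t)%:R.
Proof.
rewrite sgn_coordE sgn_vecE; under eq_bigr => i _ do rewrite mxE.
by rewrite sumr_const card_ord.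
Qed.
Lemma sgn_coord_act (S S' : finType) c (v : sgn_obj k t S) : #|S| = #|S'| ->
  sgn_coord S' (@sgn_act k t S S' c v) = c * sgn_coord S v.
Proof.
move=> SS'; rewrite sgn_actE !sgn_coordE -SS'.
move: (v : 'rV_(#|S| == t)); case: (#|S| == t) => w; last by rewrite !big_ord0 mulr0.
by rewrite big_ord1 mxE.
Qed.

Local Notation day_t := (@day_comp k (kFS k) (sgnop k t) (X, U)).

Definition coef A (h : surj (subs A) X) (x : day_t A) : k :=
  tens_val (tensmap (kfree_eval h) (sgn_coord (subs (~: A))) x).

Lemma coef_linear A (h : surj (subs A) X) c (x y : day_t A) :
  coef h (c *: x + y) = c * coef h x + coef h y.
Proof. by rewrite /coef linearP tens_val_linear. Qed.

Lemma coef_eq0 A (x : day_t A) : (forall h : surj (subs A) X, coef h x = 0) -> x = 0.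
Proof.
move=> x0; apply: (@tens_eq0 k _ _ _ unit (fun h => kfree_eval h) (fun h => kfree_line h)
  (fun=> sgn_coord (subs (~: A))) (fun=> sgn_vec (subs (~: A)))) => [v|w|h _].
- by rewrite {1}[v]kbasis_sum; apply: eq_bigr => h _; rewrite kfree_lineE kfree_evalE.
- by rewrite (big_pred1 tt) -?sgn_coordK //; case.
by apply/tens_val_eq0/x0.
Qed.

Definition day_koszul : 'Hom(dsum day_t, V) :=
  linfun (fun z : dsum day_t =>
    [ffun g => \sum_A \sum_(h : surj (subs A) X) (g == pext h)%:R * coef h (z A)] : V).

Lemma day_koszulE (z : dsum day_t) g :
  day_koszul z g = \sum_A \sum_(h : surj (subs A) X) (g == pext h)%:R * coef h (z A).
Proof.
rewrite linfun_ffunE // => c p q h; rewrite mulr_sumr -big_split; apply: eq_bigr => A _ /=.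
rewrite mulr_sumr -big_split; apply: eq_bigr => b _ /=.
by rewrite (dsumDE (V := day_t)) (dsumZE (V := day_t)) coef_linear mulrDr mulrCA.
Qed.

Lemma day_koszul_pext (z : dsum day_t) A (h : surj (subs A) X) :
  day_koszul z (pext h) = coef h (z A).
Proof.
rewrite day_koszulE (bigD1 A) //= [X in _ + X]big1 ?addr0 => [|B BA]; last first.
  apply: big1 => h' _; case: eqP => [hh|_]; last by rewrite mul0r.
  by case/eqP: BA; apply: setC_inj; rewrite -(stars_pext h) hh stars_pext.
rewrite (bigD1 h) //= eqxx mul1r big1 ?addr0 // => h' /negPf hh.
by rewrite (inj_eq (@pext_inj A)) eq_sym hh mul0r.
Qed.

Lemma day_koszul_notT (z : dsum day_t) g : pim g != setT -> day_koszul z g = 0.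
Proof.
move=> gT; rewrite day_koszulE big1 // => A _; rewrite big1 // => h _.
have [gE|_] := eqVneq g (pext h); last by rewrite mul0r.
by rewrite gE pim_pext eqxx in gT.
Qed.

Lemma day_koszul_inj z : day_koszul z = 0 -> z = 0.
Proof.
move=> z0; apply/dsumP => A; rewrite [RHS]dsum_mkE; apply: coef_eq0 => h.
by rewrite -day_koszul_pext z0 ffunE.
Qed.

Lemma day_koszul_kspace z : day_koszul z \in kspace k X U t.
Proof.
apply/kspaceP => g; rewrite /kcell.
have [gT|gT _] := eqVneq (pim g) setT; last exact: day_koszul_notT.
have [A [h ->]] := pext_onto gT; rewrite day_koszul_pext stars_pext => /= At.
rewrite /coef (@tens_val_scale k 1 0 _ _ (kfree_eval h) _ 0 _) ?mulr0 ?mul0r // => w;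
  rewrite ?mul1r //.
rewrite mul0r sgn_coordE; move: (w : 'rV_(_ == t)); rewrite card_subs (negPf At) => w'.
by rewrite big_ord0.
Qed.

Lemma day_koszul_onto y : y \in kspace k X U t -> exists z, y = day_koszul z.
Proof.
move=> /kspaceP yt.
pose z : dsum day_t := dsum_mk (fun A => \sum_(h : surj (subs A) X)
  y (pext h) *: ptens (kbasis k h) (sgn_vec (subs (~: A)) 1) : day_t A).
exists z; apply/ffunP => g; have [gT|gT] := eqVneq (pim g) setT; last first.
  by rewrite day_koszul_notT // yt // /kcell (negPf gT).
have [A [h ->]] := pext_onto gT; rewrite day_koszul_pext dsum_mkE.
have coef0 : coef h (0 : day_t A) = 0.
  have := coef_linear h (-1) 0 (0 : day_t A).
  by rewrite scaler0 addr0 mulN1r addNr.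
have coefD (p q : day_t A) : coef h (p + q) = coef h p + coef h q.
  by rewrite -[p]scale1r coef_linear mul1r scale1r.
rewrite (big_morph (coef h) coefD coef0) (bigD1 h) //= big1 ?addr0 => [|h' /negPf hh].
  rewrite -[_ *: _]addr0 coef_linear coef0 addr0 /coef tensmap_ptens tens_val_ptens.
  rewrite kfree_evalE ffunE eqxx mul1r sgn_coord_vec card_subs.
  have [At|At] := boolP (#|~: A| == t); first by rewrite mulr1.
  by rewrite yt ?mul0r // /kcell stars_pext pim_pext eqxx.
rewrite -[_ *: _]addr0 coef_linear coef0 addr0 /coef tensmap_ptens tens_val_ptens.
by rewrite kfree_evalE ffunE eq_sym hh mul0r mulr0.
Qed.

Lemma kfree_eval_act (f : @arr FBFBop (X, U) (X, U)) A B
    (r : forall v, (v \in B) = (sval f.2 v \in A)) (h : surj (subs A) X)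
    (h' : surj (subs B) X) (x : kFS k (X, subs A)) :
  h' = surj_comp (surj_of_bij f.1) (surj_comp h (surj_of_bij (restr r))) ->
  kfree_eval h' (@mact _ _ (kFS k) (X, subs A) (X, subs B) (f.1, restr r) x) = kfree_eval h x.
Proof.
move=> hE; set F := mact _ _.
rewrite -[LHS](comp_lfunE (kfree_eval h') F); apply: eq_kfree => j.
rewrite comp_lfunE !kfree_evalE [F _]kext_basis !ffunE; congr ((nat_of_bool _)%:R).
apply/idP/idP => [/eqP|/eqP <-]; last by rewrite -hE.
rewrite hE => /(congr1 (fun h => sval h)) /= /ffunP jE.
apply/eqP/val_inj/ffunP => a.
have /surjectiveP/(_ a)[b <-] := bij_surjb (restr r).
have := jE b; rewrite [X in X = _]ffunE [X in _ = X]ffunE /=.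
rewrite [X in sval f.1 X = _]ffunE [X in _ = sval f.1 X]ffunE; exact: Defs.bij_inj.
Qed.

Lemma surj_eqP (S T : finType) (p q : surj S T) :
  (forall s, sval p s = sval q s) -> p = q.
Proof. by move=> pq; apply/val_inj/ffunP. Qed.

Lemma surj_compE (S T R : finType) (p : surj T R) (q : surj S T) s :
  sval (surj_comp p q) s = sval p (sval q s).
Proof. exact: ffunE. Qed.

(** The convolution restricts [f.2] to the complements in the decompositions, which are the sets of
    stars; the sign of that restriction is the factor [rsign] of [vact]. *)
Lemma day_koszul_nat (i j : D) (f : @arr D i j) z :
  day_koszul (mact (@ev_mod k FBFBop (X, U) (day (kFS k) (sgnop k t))) f z) =
  mact (koszul k X U) f (day_koszul z).
Proof.
apply/ffunP => g; rewrite koszul_actE /vact; have [gT|gT] := eqVneq (pim g) setT; last first.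
  by rewrite !day_koszul_notT ?mulr0 // pim_transportT.
have [B [h' gE]] := pext_onto gT; rewrite {}gE {gT}.
have r := mem_bij_imset f.2 B; have r' := mem_bij_imsetC f.2 B; set A := _ @: B in r r'.
(* The only surjection that [f] carries to [h']. *)
pose h : surj (subs A) X := surj_comp (surj_of_bij (binv f.1))
  (surj_comp h' (surj_of_bij (binv (restr r)))).
have hE : h' = surj_comp (surj_of_bij f.1) (surj_comp h (surj_of_bij (restr r))).
  apply: surj_eqP => b; rewrite !surj_compE.
  rewrite -[RHS]/(sval f.1 (sval (binv f.1)
    (sval h' (sval (binv (restr r)) (sval (restr r) b))))).
  by rewrite binvK bijK.
have tE : transport f (pext h') = pext h.
  apply/ffunP => u; rewrite -[u](binvK f.2); move: (sval (binv f.2) u) => {}u.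
  rewrite transportE; have [uB|uB] := boolP (u \in B); last by rewrite !pext_notin -?r.
  pose b : subs B := exist (fun u => u \in B) u uB.
  rewrite -[u]/(sval b) -(restrE r) !pext_in; congr Some.
  rewrite /h !surj_compE.
  rewrite -[sval (surj_of_bij _) (sval (restr r) b)]/
    (sval (binv (restr r)) (sval (restr r) b)).
  by rewrite bijK.
rewrite tE !day_koszul_pext stars_pext.
rewrite [X in _ = X * _](_ : _ = bij_sign k (restr r')); last exact: esym (rsignE k r').
rewrite -[mact _ f z]/(@day_act k (kFS k) (sgnop k t) (X, U) (X, U) f z).
rewrite (@day_actE k (kFS k) (sgnop k t) (X, U) (X, U) f z B A r r') /coef /day_comp_act.
set P := mact _ _; set Q := mact _ _.
rewrite -(@tensmap_comp _ _ _ _ _ _ _ P (kfree_eval h') Q (sgn_coord (subs (~: B)))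
  (kfree_eval h) (sgn_coord (subs (~: B)) \o Q)%VF).
- rewrite -[X in X * _]mul1r; apply: tens_val_scale => w; first by rewrite mul1r.
  rewrite comp_lfunE; apply: sgn_coord_act.
  exact: esym (bij_card (restr r')).
- by move=> v; rewrite (kfree_eval_act _ hE).
by move=> w; rewrite comp_lfunE.
Qed.

Lemma K0_day : ([cls @ev_mod k FBFBop (X, U) (day (kFS k) (sgnop k t))] =K0
  [cls @submod k D (koszul k X U) (fun=> kspace k X U t) (@kspace_stable k X U t)])%K0.
Proof.
pose a := @Modmor k D (@ev_mod k FBFBop (X, U) (day (kFS k) (sgnop k t)))
  (koszul k X U) (fun=> day_koszul) day_koszul_nat.
apply: (@K0_embed k D _ _ a (fun=> kspace k X U t) (@kspace_stable k X U t)) => i /=.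
  apply/vspaceP => z; rewrite memv_ker memv0.
  by apply/eqP/eqP => [/day_koszul_inj|->]; rewrite ?linear0.
apply/vspaceP => y; apply/idP/memv_imgP => [/day_koszul_onto[z ->]|[z _ ->]].
  by exists z; rewrite ?memvf.
exact: day_koszul_kspace.
Qed.
End DayKoszul.

(** * Surjections as chains without stars *)

Section SurjKoszul.
Variables (k : fieldType) (X U : finType).
Local Notation pfun := {ffun U -> option X}.
Local Notation D := (@full1 FBFBop (X, U)).
Local Notation V := (kfree k pfun).
Local Notation kFSU := (kfree k (surj U X)).
Implicit Types (g : pfun) (f : surj U X) (x : kFSU).

Definition psurj f : pfun := [ffun u => Some (sval f u)].

Lemma psurj_inj : injective psurj.
Proof.
move=> f f' ff; apply: surj_eqP => u; apply: Some_inj.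
by have := congr1 (fun g : pfun => g u) ff; rewrite !ffunE.
Qed.

Lemma kcell0P g : reflect (exists f, g = psurj f) (kcell 0 g).
Proof.
apply: (iffP andP) => [[/eqP gT]|[f ->]]; last first.
  split; last by rewrite cards_eq0; apply/eqP/setP => u; rewrite !inE ffunE.
  apply/eqP/setP => x; rewrite in_setT; have /surjectiveP/(_ x)[u <-] := proj2_sig f.
  by apply: (@mem_pim _ _ _ u); rewrite ffunE.
rewrite cards_eq0 => /eqP g0.
have gS u : {x | g u = Some x}.
  case gu: (g u) => [x|]; first by exists x.
  by have := in_set0 u; rewrite -g0 mem_stars gu.
have fS : surjectiveb [ffun u => sval (gS u)].
  apply/surjectiveP => x; have /pimP[u gu] : x \in pim g by rewrite gT.
  exists u; rewrite ffunE; apply: Some_inj; rewrite -gu.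
  exact: esym (proj2_sig (gS u)).
exists (Surj fS); apply/ffunP => u; rewrite !ffunE; exact: (proj2_sig (gS u)).
Qed.

Definition surj_koszul : 'Hom(kFSU, V) := kext (fun f => kbasis k (psurj f)).

Lemma surj_koszulE x g : surj_koszul x g = \sum_f x f * (g == psurj f)%:R.
Proof.
rewrite kextE sum_ffunE; apply: eq_bigr => f _.
by rewrite !ffunE.
Qed.

Lemma surj_koszul_psurj x f : surj_koszul x (psurj f) = x f.
Proof.
rewrite surj_koszulE (bigD1 f) //= eqxx mulr1 big1 ?addr0 // => f' /negPf ff.
by rewrite (inj_eq psurj_inj) eq_sym ff mulr0.
Qed.

Lemma surj_koszul_kspace x : surj_koszul x \in kspace k X U 0.
Proof.
apply/kspaceP => g g0; rewrite surj_koszulE big1 // => f _.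
by case: eqP => [gE|]; rewrite ?mulr0 //; case/kcell0P: g0; exists f.
Qed.

Lemma surj_koszul_onto y :
  y \in kspace k X U 0 -> y = surj_koszul ([ffun f => y (psurj f)] : kFSU).
Proof.
move=> /kspaceP y0; apply/ffunP => g; have [/kcell0P[f ->]|g0] := boolP (kcell 0 g).
  by rewrite surj_koszul_psurj ffunE.
by rewrite y0 // (kspaceP _ _ (surj_koszul_kspace _)).
Qed.

Lemma pullE (W : finType) (i : {ffun W -> U}) x (h : surj W X) :
  pull k X i x h = \sum_f x f * (compff (sval f) i == sval h)%:R.
Proof.
rewrite kextE sum_ffunE; apply: eq_bigr => f _; rewrite ffunE; congr (_ * _).
case: insubP => [h' _ hE|hN]; first by rewrite ffunE -hE eq_sym.
by rewrite ffunE; case: eqP => // fE; rewrite fE (proj2_sig h) in hN.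
Qed.

(** The total maps obtained by filling the only star [v] in all ways are exactly the surjections
    restricting to [h] along [i], whose coefficients the pullback adds up. *)
Lemma sum_surj_koszul_upd (W : finType) (i : {ffun W -> U}) x (h : surj W X) g v :
  (forall w, g (i w) = Some (sval h w)) -> (forall w, i w != v) ->
  (forall u, u != v -> exists w, i w = u) ->
  \sum_z surj_koszul x (upd g v (Some z)) = pull k X i x h.
Proof.
move=> gi iv iS; rewrite pullE; under eq_bigr => z _ do rewrite surj_koszulE.
rewrite exchange_big; apply: eq_bigr => f _ /=; rewrite -mulr_sumr; congr (_ * _).
rewrite (bigD1 (sval f v)) //= [X in _ + X]big1 ?addr0 => [|z /eqP zf]; last first.
  case: eqP => // /(congr1 (fun g : pfun => g v)).
  by rewrite upd_eq ffunE => -[/zf].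
congr ((nat_of_bool _)%:R); apply/eqP/eqP => [gE|fE].
  apply/ffunP => w; rewrite ffunE; apply: Some_inj; rewrite -gi.
  by have := congr1 (fun g : pfun => g (i w)) gE; rewrite upd_neq // [psurj f _]ffunE.
apply/ffunP => u; rewrite [psurj f u]ffunE; have [->|uv] := eqVneq u v; first by rewrite upd_eq.
by rewrite upd_neq //; have [w <-] := iS u uv; rewrite gi -fE ffunE.
Qed.

Lemma osign_neq0 (S : {set U}) v : osign k S v != 0.
Proof.
apply/eqP => s0; have := osign_sqr k S v.
by rewrite s0 mul0r => /esym/eqP; rewrite oner_eq0.
Qed.

Lemma kdiff_stars1 (y : pfun -> k) g v : stars g = [set v] ->
  kdiff setT y g = osign k [set v] v * \sum_z y (upd g v (Some z)).
Proof.
move=> gv; rewrite /kdiff mulr_sumr; apply: eq_big => [z|z _]; first by rewrite inE.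
by rewrite /delta gv big_set1.
Qed.

(** Maps onto X with one star [v] are surjections from U minus [v]; there the differential is, up to
    an orientation sign, the pullback along the inclusion. *)
Lemma diff_surj_koszul_eq0 x : (diff k X U (surj_koszul x) == 0) = (x \in kFS0_space k U X).
Proof.
apply/eqP/kFS0P => [dx0 W i iI cW|xP].
  have [v iv] : exists v, ~: (i @: setT) = [set v].
    apply/cards1P; rewrite -(eqn_add2l #|i @: setT|) cardsC card_imset // cardsT.
    by rewrite addn1 cW.
  have iN w : i w != v.
    have : i w \notin ~: (i @: setT) by rewrite inE negbK imset_f.
    by rewrite iv inE.
  have iS u : u != v -> exists w, i w = u.
    move=> uv; have : u \notin ~: (i @: setT) by rewrite iv inE.
    by rewrite inE negbK => /imsetP[w _ ->]; exists w.
  apply/ffunP => h; rewrite [RHS]ffunE.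
  (* [h] moved to U along [i], with a star at the missed point. *)
  pose g : pfun := [ffun u => omap (sval h) [pick w | i w == u]].
  have gi w : g (i w) = Some (sval h w).
    by rewrite ffunE; case: pickP => [w' /eqP/iI->//|/(_ w)]; rewrite eqxx.
  have gv : stars g = [set v].
    apply/setP => u; rewrite mem_stars inE; have [->|uv] := eqVneq u v.
      by rewrite ffunE; case: pickP => // w; rewrite (negPf (iN w)).
    by have [w <-] := iS u uv; rewrite gi.
  have gT : pim g = setT.
    apply/setP => z; rewrite in_setT; have /surjectiveP/(_ z)[w <-] := proj2_sig h.
    by apply: mem_pim (gi w).
  have : @kdiff k X U setT (surj_koszul x) g = 0.
    transitivity (diff k X U (surj_koszul x) g); first by rewrite diffE gT eqxx.
    by rewrite dx0 [LHS]ffunE.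
  rewrite (kdiff_stars1 _ gv) => /eqP; rewrite mulf_eq0 (negPf (osign_neq0 _ _)) /=.
  by rewrite (sum_surj_koszul_upd _ gi iN iS) => /eqP.
apply/ffunP => g; rewrite diffE [RHS]ffunE; case: eqP => // gT.
have [/cards1P[v gv]|g1] := boolP (#|stars g| == 1%N); last first.
  (* With another number of stars, no filling of a star is a total map. *)
  rewrite /kdiff big1 // => z _; rewrite /delta big1 // => v vS.
  rewrite (kspaceP _ _ (surj_koszul_kspace x)) ?mulr0 // /kcell stars_upd negb_and.
  by apply/orP; right; move: g1; rewrite (cardsD1 v (stars g)) vS.
rewrite (kdiff_stars1 _ gv); have [A [h gE]] := pext_onto gT.
pose i : {ffun subs A -> U} := [ffun a => sval a].
have AC : ~: A = [set v] by rewrite -gv gE stars_pext.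
have AE : A = ~: [set v] by rewrite -AC setCK.
rewrite (@sum_surj_koszul_upd _ i x h) ?xP ?ffunE ?mulr0 //.
- by move=> a b; rewrite !ffunE; apply: val_inj.
- by rewrite card_subs -(cardsC A) AC cards1 addn1.
- by move=> a; rewrite ffunE gE pext_in.
- by case=> u uA; rewrite ffunE /=; move: uA; rewrite AE !inE.
move=> u uv; have uA : u \in A by rewrite AE !inE.
by exists (exist (fun u => u \in A) u uA); rewrite ffunE.
Qed.

Lemma rsign0 (s : bij U U) : rsign k s set0 = 1.
Proof.
have E : subs (set0 : {set U}) -> False by case=> u; rewrite inE.
rewrite /rsign /bij_sign (_ : bij_perm _ = 1%g) ?odd_perm1 //.
by apply/permP => a; case: (E a).
Qed.

Lemma surj_koszul_nat (i j : D) (f : @arr D i j) x :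
  surj_koszul (kFS_act k f x) = mact (koszul k X U) f (surj_koszul x).
Proof.
rewrite -[LHS](comp_lfunE surj_koszul (kFS_act k f)) -[RHS](comp_lfunE _ surj_koszul).
apply: eq_kfree => h; rewrite !comp_lfunE !kext_basis.
apply/ffunP => g; rewrite koszul_actE /vact ffunE.
set h' := surj_comp _ _.
have tE : transport f (psurj h') = psurj h.
  apply/ffunP => u; rewrite -[u](binvK f.2); move: (sval (binv f.2) u) => {}u.
  rewrite transportE ![psurj _ _]ffunE; congr Some; rewrite /h' !surj_compE.
  by rewrite -[sval (surj_of_bij f.1) _]/(sval f.1 _) bijK.
have [->|gh] := eqVneq g (psurj h').
  rewrite tE ffunE eqxx mulr1 (_ : stars _ = set0) ?rsign0 //.
  by apply/setP => u; rewrite !inE ffunE.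
rewrite [kbasis k _ _]ffunE; case: eqP => [tg|_]; last by rewrite mulr0.
case/eqP: gh; apply/ffunP => u.
have : omap (sval (binv f.1)) (g u) = omap (sval (binv f.1)) (psurj h' u).
  by rewrite -!transportE tE tg.
rewrite ffunE; case: (g u) => //= z [/(congr1 (sval f.1))]; rewrite !binvK => ->.
by [].
Qed.

(** [I] is a parameter because the cycles in degree 0 are presented in two ways: as a kernel when
    |X| < |U|, and as all chains when |U| <= |X|. *)
Lemma K0_kFS0 (I : {vspace V})
    (hI : forall (i j : D) (f : @arr D i j) y, y \in I -> mact (koszul k X U) f y \in I) :
  I = (kspace k X U 0%N :&: lker (diff k X U))%VS ->
  ([cls @ev_mod k FBFBop (X, U) (kFS0 k)] =K0
   [cls @submod k D (koszul k X U) (fun=> I) hI])%K0.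
Proof.
move=> IE; pose ph : 'Hom(kFS0 k (X, U), V) :=
  linfun (fun x : subvs_of (kFS0_space k U X) => surj_koszul (vsval x)).
have phE (x : subvs_of (kFS0_space k U X)) : ph x = surj_koszul (vsval x).
  by rewrite linfunE // => c p q; rewrite !linearP.
have phn (i j : D) (f : @arr D i j) (x : @ev_mod k FBFBop (X, U) (kFS0 k) i) :
    ph (mact (@ev_mod k FBFBop (X, U) (kFS0 k)) f x) = mact (koszul k X U) f (ph x).
  apply: (etrans (phE _)); rewrite [ph x]phE -surj_koszul_nat; congr (surj_koszul _).
  exact: (submod_actE (@kFS0_stable k) f x).
pose a := @Modmor k D (@ev_mod k FBFBop (X, U) (kFS0 k)) (koszul k X U) (fun=> ph) phn.
apply: (@K0_embed k D _ _ a (fun=> I) hI) => i /=.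
  apply/vspaceP => x; rewrite memv_ker memv0; apply/eqP/eqP => [px|->]; last exact: linear0.
  apply: val_inj; apply/ffunP => f; rewrite -[LHS]surj_koszul_psurj -[surj_koszul _]phE px.
  by rewrite [LHS]ffunE [RHS]ffunE.
apply/vspaceP => y; rewrite IE memv_cap; apply/andP/memv_imgP => [[y0 dy]|[x _ ->]].
  have yE := surj_koszul_onto y0; rewrite yE memv_ker diff_surj_koszul_eq0 in dy.
  by exists (vsproj (kFS0_space k U X) [ffun f => y (psurj f)]); rewrite ?memvf // phE vsprojK.
by rewrite phE surj_koszul_kspace memv_ker diff_surj_koszul_eq0; split=> //; exact: subvsP.
Qed.
End SurjKoszul.

(** * External products of sign representations *)

Section SignBox.
Variables (k : fieldType) (X U : finType).
Local Notation D := (@full1 FBFBop (X, U)).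
Local Notation sgnbox a b := (@ev_mod k FBFBop (X, U) (box (sgn k a) (sgnop k b))).

Lemma sgn_obj_null (t : nat) (S : finType) (v : sgn_obj k t S) : #|S| != t -> v = 0.
Proof.
by move=> /negPf St; move: v; rewrite /sgn_obj St => v; apply/rowP; case.
Qed.

Lemma K0_sgnbox_null (a b : nat) :
  (#|X| != a) || (#|U| != b) -> ([cls sgnbox a b] =K0 0)%K0.
Proof.
move=> ab; apply: K0_null => i x.
case/orP: ab => h.
  apply: (@tens_eq0 k _ _ void unit (fun=> 0) (fun=> 0)
    (fun=> sgn_coord k b U) (fun=> sgn_vec k b U)).
  - by move=> v; rewrite (sgn_obj_null v h) big1.
  - by move=> w; rewrite (big_pred1 tt) -?sgn_coordK //; case.
  - by case.
apply: (@tens_eq0 k _ _ unit void (fun=> sgn_coord k a X)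
  (fun=> sgn_vec k a X) (fun=> 0) (fun=> 0)).
- by move=> w; rewrite (big_pred1 tt) -?sgn_coordK //; case.
- by move=> v; rewrite (sgn_obj_null v h) big1.
- by move=> _; case.
Qed.

Lemma K0_sgnbox : ([cls sgnbox #|X| #|U|] =K0 [cls signmod k X U])%K0.
Proof.
pose sX := sgn_coord k #|X| X; pose sU := sgn_coord k #|U| U.
pose q : 'Hom(tens (sgn_obj k #|X| X) (sgn_obj k #|U| U), k^o) :=
  linfun (fun x => (tens_val (tensmap sX sU x) : k^o)).
have qE x : q x = tens_val (tensmap sX sU x).
  by rewrite linfunE // => c p r; rewrite linearP tens_val_linear.
have qn (i j : D) (f : @arr D i j) (x : sgnbox #|X| #|U| i) :
    q (mact (sgnbox #|X| #|U|) f x) = mact (signmod k X U) f (q x).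
  rewrite [RHS]sign_actE !qE.
  set P := @sgn_act k #|X| X X (bij_sign k f.1).
  set Q := @sgn_act k #|U| U U (bij_sign k f.2).
  rewrite -[mact _ f x]/(tensmap P Q x).
  rewrite -(@tensmap_comp _ _ _ _ _ _ _ P sX Q sU (sX \o P)%VF (sU \o Q)%VF) //.
  - by apply: tens_val_scale => w; rewrite comp_lfunE; apply: sgn_coord_act.
  - by move=> w; rewrite comp_lfunE.
  - by move=> w; rewrite comp_lfunE.
pose a := @Modmor k D (sgnbox #|X| #|U|) (signmod k X U) (fun=> q) qn.
apply: (@K0_iso k D _ _ a) => i /=.
  apply/vspaceP => x; rewrite memv_ker memv0; apply/eqP/eqP => [qx|->]; last exact: linear0.
  apply: (@tens_eq0 k _ _ unit unit (fun=> sX)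
    (fun=> sgn_vec k #|X| X) (fun=> sU) (fun=> sgn_vec k #|U| U)).
  - by move=> w; rewrite (big_pred1 tt) -?sgn_coordK //; case.
  - by move=> w; rewrite (big_pred1 tt) -?sgn_coordK //; case.
  by move=> _ _; apply: tens_val_eq0; rewrite -qE.
apply/vspaceP => c; rewrite memvf; apply/memv_imgP.
exists ((c : k) *: ptens (sgn_vec k #|X| X 1) (sgn_vec k #|U| U 1)); rewrite ?memvf // linearZ.
by rewrite /= qE tensmap_ptens tens_val_ptens !sgn_coord_vec !eqxx mulr1 [RHS]mulr1.
Qed.
End SignBox.

(** * The Euler characteristic *)

Section Assembly.
Variables (k : fieldType) (X U : finType).
Hypothesis char0 : [pchar k] =i pred0.
Local Notation D := (@full1 FBFBop (X, U)).
Local Notation K := (koszul k X U).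
Local Notation C t := (@submod k D K (fun=> kspace k X U t) (@kspace_stable k X U t)).
Local Notation day_t t := (@ev_mod k FBFBop (X, U) (day (kFS k) (sgnop k t))).

Lemma kspace_eq0 t y : y \in kspace k X U t -> (#|U| < #|X| + t)%N -> y = 0.
Proof.
move=> /kspaceP yt Ut; apply/ffunP => g; rewrite [RHS]ffunE yt // /kcell.
by apply/negP => /andP[/eqP/card_pimT gU /eqP gt]; rewrite -gt ltnNge gU in Ut.
Qed.

Lemma K0_day_null t : (#|U| < #|X| + t)%N -> ([cls day_t t] =K0 0)%K0.
Proof.
move=> Ut; rewrite K0_day; apply: K0_null => i v; apply: val_inj.
exact: (kspace_eq0 (subvsP v) Ut).
Qed.

Definition boundaries t : {vspace kfree k {ffun U -> option X}} :=
  (diff k X U @: kspace k X U t)%VS.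

Lemma boundaries_stable t (i j : D) (f : @arr D i j) y :
  y \in boundaries t -> mact K f y \in boundaries t.
Proof.
case/memv_imgP => b bt ->; rewrite -diff_nat memv_img //.
exact: kspace_stable.
Qed.
Local Notation B t := (@submod k D K (fun=> boundaries t) (@boundaries_stable t)).

Lemma cycles_stable (i j : D) (f : @arr D i j) y :
  y \in (kspace k X U 0%N :&: lker (diff k X U))%VS ->
  mact K f y \in (kspace k X U 0%N :&: lker (diff k X U))%VS.
Proof.
rewrite !memv_cap => /andP[y0 yd]; rewrite (kspace_stable f y0) /=.
move: yd; rewrite !memv_ker => /eqP yd; by rewrite diff_nat yd linear0.
Qed.
Local Notation Z0 := (@submod k D K
  (fun=> (kspace k X U 0%N :&: lker (diff k X U))%VS) cycles_stable).

(** A cycle killed by the augmentation is a boundary by [diff_exact]; the augmentation constrains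
    chains only in degree |U| - |X|. *)
Lemma boundariesE t : boundaries t =
  (kspace k X U t.+1 :&: lker (diff k X U) :&: lker (augL k X U))%VS.
Proof.
apply/vspaceP => y; rewrite !memv_cap; apply/memv_imgP/andP => [[b bt ->]|[/andP[yt]]].
  by rewrite diff_kspace // !memv_ker diff_sqr // augL_diff // eqxx.
rewrite !memv_ker => /eqP dy /eqP ay.
by have [b bt ->] := diff_exact char0 yt dy ay; exists b.
Qed.

(** Below the top degree the augmentation is zero on chains, so all cycles are boundaries. *)
Lemma K0_cell_low t : (#|X| + t.+1 < #|U|)%N ->
  ([cls C t.+1] =K0 [cls B t] + [cls B t.+1])%K0.
Proof.
move=> tU; apply: (@K0_image k D K K (diffM k X U)) => i //=.
rewrite boundariesE; apply/vspaceP => y; rewrite !memv_cap.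
have [yt /=|//] := boolP (y \in kspace k X U t.+1).
by rewrite [X in _ && X]memv_ker (augL_kspace yt) ?eqxx ?andbT // neq_ltn tU.
Qed.

Lemma K0_cell0 : ([cls C 0%N] =K0 [cls Z0] + [cls B 0%N])%K0.
Proof. exact: (@K0_image k D K K (diffM k X U)). Qed.

(** No map onto X has more stars, so every chain is a cycle; the boundaries are the kernel of the
    augmentation, which is onto. *)
Lemma K0_cell_top t : (#|X| + t.+1 = #|U|)%N ->
  ([cls C t.+1] =K0 [cls B t] + [cls signmod k X U])%K0.
Proof.
move=> tU; apply: (@K0_surj k D K (signmod k X U) (augM k X U)) => i /=.
  rewrite boundariesE; apply/vspaceP => y; rewrite !memv_cap.
  have [yt /=|//] := boolP (y \in kspace k X U t.+1).
  rewrite [X in X && _]memv_ker (@kspace_eq0 t.+2 (diff k X U y)) ?eqxx //.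
    exact: diff_kspace.
  by rewrite addnS tU.
have [|y yt ay] := @augL_surj k X U; first by rewrite -tU leq_addr.
have {}yt : y \in kspace k X U t.+1 by rewrite -tU addKn in yt.
apply/vspaceP => c; rewrite memvf; apply/memv_imgP.
exists ((c / augL k X U y : k) *: y); first by rewrite memvZ.
by rewrite linearZ /=; apply/esym; apply: divfK.
Qed.

Lemma K0_koszul : (#|X| < #|U|)%N ->
  (K0sum (iota 0 (#|U| - #|X|).+1) (fun t => K0sgn t [cls C t]) =K0
   [cls Z0] + K0sgn (#|U| - #|X|) [cls signmod k X U])%K0.
Proof.
move=> XU; set d := (_ - _)%N; have d0 : (0 < d)%N by rewrite subn_gt0.
have XdU : (#|X| + d)%N = #|U| by rewrite subnKC // ltnW.
(* Boundaries in degree [t] come from chains with [t.-1] stars, whence the shift; [b 0] is a dummy.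
   The slot after the top degree holds the sign representation. *)
pose b t := if t is t'.+1 then
  (if t' == d then [cls signmod k X U] else [cls B t'])%K0 else K0zero.
pose z t := if t == 0%N then [cls Z0]%K0 else b t.
have := @K0_telescope k D (fun t => [cls C t])%K0 z b d.
rewrite /z /b /= eqxx; apply=> [t|t /andP[t0 _]]; last first.
  by case: t t0 => //= t _; apply: K0eq_refl.
rewrite leq_eqVlt => /predU1P[->|td].
  rewrite eqxx; case E: d d0 => [//|d'] _ /=; rewrite (ltn_eqF (ltnSn d')).
  by apply: K0_cell_top; rewrite -E.
rewrite (ltn_eqF td); case: t td => [|t] td /=; first exact: K0_cell0.
rewrite (ltn_eqF (ltnW td)); apply: K0_cell_low.
by rewrite -XdU ltn_add2l.
Qed.
End Assembly.

Lemma K0sum_proper (k : fieldType) (C : category) (I : Type) (r : seq I)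
    (c c' : I -> K0 k C) :
  (forall i, c i =K0 c' i)%K0 -> (K0sum r c =K0 K0sum r c')%K0.
Proof.
by move=> cc; elim: r => [|i r IH] /=; [exact: K0eq_refl | exact: K0eq_add].
Qed.

Lemma K0sgn_null (k : fieldType) (C : category) n (p : K0 k C) :
  (p =K0 0 -> K0sgn n p =K0 0)%K0.
Proof. by rewrite /K0sgn; case: odd => // ->; exact: K0opp0. Qed.

Theorem theorem1p4 (k : fieldType) (char0 : [pchar k]%R =i pred0)
    (X U : finType) :
  exists L R : K0 k (@full1 FBFBop (X, U)),
    [/\ @is_sum_at k FBFBop (X, U) {p : nat * nat | (p.1 < p.2)%N}
          (fun p => let: (a, b) := sval p in
             K0sgn (b - a) [cls box (sgn k a) (sgnop k b)]%K0) L,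
        @is_sum_at k FBFBop (X, U) nat
          (fun t => [cls kFS k] ⊙ K0sgn t [cls sgnop k t])%K0 R
      & (@ev k FBFBop (X, U) [cls kFS0 k] + L =K0 R)%K0].
Proof.
set cL := fun p : {p : nat * nat | (p.1 < p.2)%N} => _; set cR := fun t : nat => _.
pose D := @full1 FBFBop (X, U).
have cRE t : @ev k FBFBop (X, U) (cR t) =
    K0sgn t [cls @ev_mod k FBFBop (X, U) (day (kFS k) (sgnop k t))]%K0.
  by rewrite /cR /K0sgn; case: odd.
have cLE a b ab : @ev k FBFBop (X, U) (cL (exist _ (a, b) ab)) =
    K0sgn (b - a) [cls @ev_mod k FBFBop (X, U) (box (sgn k a) (sgnop k b))]%K0.
  by rewrite /cL /K0sgn /=; case: odd.
(* At (X, U) the only sign term that can be nonzero belongs to the pair of cardinalities, present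
   when |X| < |U|; [insub] decides this. *)
pose pXU : option {p : nat * nat | (p.1 < p.2)%N} := insub (#|X|, #|U|).
(* Degrees beyond |U| - |X| contribute zero; if |U| < |X| the truncated difference leaves degree 0,
   which is zero as well. *)
pose rR := iota 0 (#|U| - #|X|).+1.
exists (if pXU is Some p then @ev k FBFBop (X, U) (cL p) else K0zero).
exists (K0sum rR (fun t => @ev k FBFBop (X, U) (cR t))); split.
- exists (if pXU is Some p then [:: p] else [::]); split.
  + by case: pXU.
  + case=> -[a b] ab; rewrite cLE => abr; apply/K0sgn_null/K0_sgnbox_null.
    rewrite -negb_and; apply: contra abr => /andP[/eqP aX /eqP bU].
    by rewrite /pXU insubT aX bU //= => ab'; rewrite inE; apply/eqP/val_inj.
  by case: pXU => [p|] /=; [apply/K0eq_sym/K0addr0 | apply: K0eq_refl].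
- exists rR; split; [exact: iota_uniq | move=> t | exact: K0eq_refl].
  rewrite mem_iota add0n /= ltnS -ltnNge cRE => td.
  apply/K0sgn_null/K0_day_null/(@leq_ltn_trans (#|X| + (#|U| - #|X|))).
    by rewrite -leq_subLR.
  by rewrite ltn_add2l.
have -> : (K0sum rR (fun t => @ev k FBFBop (X, U) (cR t)) =K0
    K0sum rR (fun t => K0sgn t [cls @submod k D (koszul k X U)
      (fun=> kspace k X U t) (@kspace_stable k X U t)]))%K0.
  by apply: K0sum_proper => t; rewrite cRE; apply/K0sgn_proper/K0_day.
rewrite /pXU; case: insubP => [[[a b] /= ab] _ [aX bU]|/= XU].
  have XU : (#|X| < #|U|)%N by rewrite -aX -bU.
  apply: K0eq_trans _ (K0eq_sym (K0_koszul char0 XU)); rewrite cLE aX bU.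
  by apply: K0eq_add; [exact: K0_kFS0 | apply/K0sgn_proper/K0_sgnbox].
(* For |U| <= |X| there is no sign term, and the complex is concentrated in degree 0, where every
   chain is a cycle. *)
rewrite /rR; have -> : (#|U| - #|X|)%N = 0%N by apply/eqP; rewrite subn_eq0 leqNgt.
rewrite /= !K0addr0; apply: K0_kFS0; apply/vspaceP => y; rewrite memv_cap.
have [yt /=|//] := boolP (y \in kspace k X U 0).
rewrite memv_ker (@kspace_eq0 k X U 1 (diff k X U y)) ?eqxx //; first exact: diff_kspace.
by rewrite addn1 ltnS leqNgt.
Qed.
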